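(* Let $f:\mathbb{R}^n\to\mathbb{R}$ be twice continuously differentiable, let $\{x_k\}$ be generated by the MINRES-based linesearch method described in the context, and let $\mathcal A:=\{x^*:\liminf_{k\to\infty}\|x_k-x^*\|=0\}$ be the set of accumulation points of $\{x_k\}$. Suppose that: (1) $\nabla^2 f$ is locally Lipschitz continuous on a neighborhood $V_H$ of $\mathcal A$; (2) $B_k=\nabla^2 f(x_k)$ for all $k\in\mathbb{N}$; (3) $\theta_k=\min\{\mathsf B,b_k\|g_k\|^{\beta}\}$ for all $k$, with $\mathsf B,\beta>0$, $b_k\ge\bar b>0$; (4) $\zeta_k=\min\{\mathsf Z,z_k\|g_k\|^{\zeta}\}$ for all $k$, with $\mathsf Z>0$, $\zeta\in(0,1]$, $z_k\ge\bar z>0$; (5) $\sum_{k=1}^\infty a_k^{-1/\alpha}<\infty$ and $\sum_{k=1}^\infty z_k^{-1/\zeta}<\infty$; (6) $b_{k+1}/b_k\to1$, $z_{k+1}/z_k\to1$, $\zeta_k\ge2\min\{\mathsf A,a_k\|g_k\|^{\alpha}\}$ for all $k$, $\theta_k=\mathcal O(\zeta_k)$ as $k\to\infty$, and $\sigma\in(0,\frac12)$. Suppose that the method does not stop after finitely many iterations and that $x^*\in\mathcal A$ is an accumulation point of $\{x_k\}$ that is a local minimum of $f$ (possibly non-isolated) and at which $f$ satisfies the Łojasiewicz property with exponent $\theta=\frac12$. Then the sequence $\{\|\nabla f(x_k)\|\}$ converges superlinearly to zero with order $1+\omega$, where $\omega\in(0,\min\{\beta,\zeta\})$.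
   Context: Notation: $\|\cdot\|$ is the Euclidean norm for vectors and the spectral norm for matrices; $\mathbb S_n$ is the set of symmetric real $n\times n$ matrices; $g_k:=\nabla f(x_k)$. Superlinear convergence of $\{\|\nabla f(x_k)\|\}$ to zero with order $1+\omega$ means $\|\nabla f(x_k)\|\to0$ and $\|\nabla f(x_{k+1})\|=\mathcal O(\|\nabla f(x_k)\|^{1+\omega})$ as $k\to\infty$. Łojasiewicz property: $f$ has the Łojasiewicz property at $\bar x$ with exponent $\theta\in[0,1)$ if there exist $c>0$, $\eta\in(0,\infty]$ and a neighborhood $V$ of $\bar x$ such that, with $\varrho(t)=ct^{1-\theta}$, $\varrho'(f(x)-f(\bar x))\,\|\nabla f(x)\|\ge1$ for all $x\in V$ with $0<f(x)-f(\bar x)<\eta$. MINRES routine (exact arithmetic). Given $A\in\mathbb S_n$, $b\in\mathbb{R}^n\setminus\{0\}$ and a tolerance $\theta\ge 0$, let $\mathcal K_t(A,b)=\mathrm{span}\{b,Ab,\dots,A^{t-1}b\}$, $p_0=0$, $p_t=\mathrm{argmin}_{p\in\mathcal K_t(A,b)}\|b-Ap\|$ and $r_t=b-Ap_t$. $\mathrm{MINRES}(A,b,\theta)$ performs, for $t=1,2,\dots$: (1) if $r_{t-1}^\top A r_{t-1}\le 0$ (non-positive curvature is detected), stop and return $d=\|b\|\, r_{t-1}/\|r_{t-1}\|$ with flag NPC; (2) otherwise compute $p_t$; if $\|r_t\|\le\theta\|b\|$, stop and return $d=p_t$ with flag SOL; otherwise continue with $t+1$. MINRES-based linesearch method. Input: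 $x_0\in\mathbb{R}^n$, $\rho,\sigma\in(0,1)$, $\alpha\in(0,1]$, $\mathsf A\in(0,1]$, $s>0$, tolerances $\theta_k\ge0$, parameters $a_k\ge\bar a>0$, and $\zeta_k\ge 0$. For $k=0,1,\dots$: set $g_k=\nabla f(x_k)$, choose $B_k\in\mathbb S_n$ (an approximation of $\nabla^2 f(x_k)$), and set $\bar B_k=B_k+\zeta_k I$. If $g_k=0$, stop. Otherwise compute $(d_k,\mathrm{flag}_k)$ by $\mathrm{MINRES}(\bar B_k,-g_k,\theta_k)$. If $\mathrm{flag}_k=\mathrm{SOL}$ and $d_k^\top\bar B_kd_k<\min\{\mathsf A,a_k\|g_k\|^{\alpha}\}\|d_k\|^2$, then reset $d_k=-g_k$ and $\mathrm{flag}_k=\mathrm{GD}$. Determine the step size $\lambda_k$ as follows and set $x_{k+1}=x_k+\lambda_kd_k$: - If $\mathrm{flag}_k\in\{\mathrm{SOL},\mathrm{GD}\}$: $\lambda_k=s\rho^j$ with $j\ge0$ the smallest integer such that $f(x_k+\lambda_kd_k)-f(x_k)\le\sigma\lambda_kd_k^\top g_k$. - If $\mathrm{flag}_k=\mathrm{NPC}$: consider the condition $(\ast)$ $f(x_k+\lambda d_k)-f(x_k)\le\sigma\lambda g_k^\top d_k+\frac{\sigma}{2}\lambda^2d_k^\top B_kd_k$. If $(\ast)$ fails for $\lambda=s$, then $\lambda_k=s\rho^j$ with $j$ the smallest positive integer such that $(\ast)$ holds for $\lambda = s\rho^j$. If $(\ast)$ holds for $\lambda=s$, then $\lambda_k=s\rho^{-j}$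 with $j\ge0$ the largest integer such that $(\ast)$ holds for all $\lambda=s,s\rho^{-1},\dots,s\rho^{-j}$ (forward linesearch). Whenever the method is said to generate $\{x_k\}$, it is implicitly assumed that each forward linesearch stops after finitely many steps.
   Formalization: The initial trial step size is assumed to be s = 1; for arbitrary s > 0 the claim fails: with f(t) = t^2/2 and s = 1/2 the step size 1/2 is always accepted and the convergence is only linear. *)

(* Defs.v *)
From HB Require Import structures.
From mathcomp Require Import all_boot all_order all_algebra.
From mathcomp Require Import all_classical all_reals all_analysis.
Set Implicit Arguments.
Unset Strict Implicit.
Unset Printing Implicit Defensive.
Import Order.TTheory GRing.Theory Num.Theory.
Import numFieldNormedType.Exports.
Local Open Scope classical_set_scope.
Local Open Scope ring_scope.

(* R^n is 'cV[R]_n.  The library norm `|_| on matrices is the max norm, so the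
   Euclidean and spectral norms are defined here; the topology is the same. *)

Definition edot (R : realType) (n : nat) (u v : 'cV[R]_n) : R :=
  \sum_(i < n) u i 0 * v i 0.

Definition enorm (R : realType) (n : nat) (u : 'cV[R]_n) : R :=
  Num.sqrt (edot u u).

Definition specnorm (R : realType) (n : nat) (M : 'M[R]_n) : R :=
  sup [set enorm (M *m v) | v in [set v : 'cV[R]_n | enorm v <= 1]].

Definition symmetric_mx (R : realType) (n : nat) (M : 'M[R]_n) : Prop :=
  M^T = M.

Definition grad (R : realType) (n : nat) (f : 'cV[R]_n -> R) (x : 'cV[R]_n)
    : 'cV[R]_n :=
  \col_(i < n) 'D_(delta_mx i 0) f x.

(* Entry (i, j) is the i-th partial derivative of the j-th component of the
   gradient, i.e. the partial derivative d_i d_j f. *)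
Definition hess (R : realType) (n : nat) (f : 'cV[R]_n -> R) (x : 'cV[R]_n)
    : 'M[R]_n :=
  \matrix_(i < n, j < n) ('D_(delta_mx i 0) (grad f) x) j 0.

Definition twice_continuously_differentiable (R : realType) (n : nat)
    (f : 'cV[R]_n -> R) : Prop :=
  [/\ forall x, differentiable f x,
      forall x, differentiable (grad f) x
    & continuous (hess f)].

Definition locally_lipschitz_mx (R : realType) (n : nat) (V : set 'cV[R]_n)
    (H : 'cV[R]_n -> 'M[R]_n) : Prop :=
  forall x, V x -> exists L : R, exists2 U, nbhs x U &
    forall y z, (U `&` V) y -> (U `&` V) z ->
      specnorm (H y - H z) <= L * enorm (y - z).

Definition local_minimum (R : realType) (n : nat) (f : 'cV[R]_n -> R)
    (xs : 'cV[R]_n) : Prop :=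
  \forall x \near xs, f xs <= f x.

(* liminf_k ||x_k - x*|| = 0, the liminf being taken in \bar R, where it always
   exists (the real-valued limn_inf is junk on sequences tending to +oo). *)
Definition accumulation_points (R : realType) (n : nat) (x : nat -> 'cV[R]_n)
    : set 'cV[R]_n :=
  [set xs | limn_einf (fun k => (enorm (x k - xs))%:E) = 0%E].

Definition has_lojasiewicz (R : realType) (n : nat) (f : 'cV[R]_n -> R)
    (xb : 'cV[R]_n) (expo : R) : Prop :=
  exists (c : R) (eta : \bar R),
    [/\ 0 < c, (0 < eta)%E &
      \forall x \near xb,
        0 < f x - f xb -> ((f x - f xb)%:E < eta)%E ->
        1 <= derive1 (fun t : R => c * t `^ (1 - expo)) (f x - f xb)
             * enorm (grad f x)].

Definition superlinear_to_zero (R : realType) (u : nat -> R) (order : R)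
    : Prop :=
  u @ \oo --> 0 /\
  (fun k => u k.+1 : R^o) =O_\oo (fun k => u k `^ order : R^o).

Inductive direction_flag := SOL | NPC | GD.

Definition krylov (R : realType) (n : nat) (A : 'M[R]_n) (b : 'cV[R]_n)
    (t : nat) : {vspace 'cV[R]_n} :=
  <<[seq iter i (mulmx A) b | i <- iota 0 t]>>%VS.

Definition krylov_argmin (R : realType) (n : nat) (A : 'M[R]_n) (b : 'cV[R]_n)
    (t : nat) (p : 'cV[R]_n) : Prop :=
  p \in krylov A b t /\
  forall q, q \in krylov A b t -> enorm (b - A *m p) <= enorm (b - A *m q).

(* [minres A b theta d fl]: the routine stops and returns direction d with flag
   fl.  The iterates p_t are also specified past the stopping index t, which is
   harmless since minimizers over K_t always exist. *)
Definition minres (R : realType) (n : nat) (A : 'M[R]_n) (b : 'cV[R]_n)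
    (theta : R) (d : 'cV[R]_n) (fl : direction_flag) : Prop :=
  exists p : nat -> 'cV[R]_n,
    [/\ p 0%N = 0, forall t, (0 < t)%N -> krylov_argmin A b t (p t) &
      let r t := b - A *m p t in
      let npc t := edot (r t.-1) (A *m r t.-1) <= 0 in
      let sol t := enorm (r t) <= theta * enorm b in
      exists t, [/\ (0 < t)%N,
        forall i, (0 < i < t)%N -> ~~ npc i && ~~ sol i &
        if npc t then fl = NPC /\ d = (enorm b / enorm (r t.-1)) *: r t.-1
        else [/\ sol t, fl = SOL & d = p t]]].

Definition safeguard (R : realType) (n : nat) (g : 'cV[R]_n) (Bbar : 'M[R]_n)
    (thr : R) (d : 'cV[R]_n) (fl : direction_flag)
    : 'cV[R]_n * direction_flag :=
  match fl with
  | SOL => if edot d (Bbar *m d) < thr * enorm d ^+ 2 then (- g, GD)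
           else (d, SOL)
  | _ => (d, fl)
  end.

Definition armijo (R : realType) (n : nat) (f : 'cV[R]_n -> R) (sigma : R)
    (x d : 'cV[R]_n) (lam : R) : bool :=
  f (x + lam *: d) - f x <= sigma * lam * edot d (grad f x).

Definition curvature_armijo (R : realType) (n : nat) (f : 'cV[R]_n -> R)
    (sigma : R) (B : 'M[R]_n) (x d : 'cV[R]_n) (lam : R) : bool :=
  f (x + lam *: d) - f x <=
    sigma * lam * edot (grad f x) d
    + sigma / 2 * lam ^+ 2 * edot d (B *m d).

Definition backtracking (R : realType) (cond : R -> bool) (s rho : R)
    (j0 : nat) (lam : R) : Prop :=
  exists j, [/\ (j0 <= j)%N, cond (s * rho ^+ j),
    forall i, (j0 <= i)%N -> cond (s * rho ^+ i) -> (j <= i)%N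
    & lam = s * rho ^+ j].

(* Existence of the largest j encodes that the forward linesearch stops. *)
Definition forward_search (R : realType) (cond : R -> bool) (s rho lam : R)
    : Prop :=
  let accepted j := forall i, (i <= j)%N -> cond (s * rho ^- i) in
  exists j, [/\ accepted j, forall j', accepted j' -> (j' <= j)%N
    & lam = s * rho ^- j].

Definition stepsize (R : realType) (n : nat) (f : 'cV[R]_n -> R)
    (rho sigma s : R) (B : 'M[R]_n) (x d : 'cV[R]_n) (fl : direction_flag)
    (lam : R) : Prop :=
  match fl with
  | SOL | GD => backtracking (armijo f sigma x d) s rho 0 lam
  | NPC =>
      let cond := curvature_armijo f sigma B x d in
      if cond s then forward_search cond s rho lam
      else backtracking cond s rho 1 lam
  end.

Definition minres_ls_step (R : realType) (n : nat) (f : 'cV[R]_n -> R)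
    (rho sigma alpha cA s theta a zeta : R) (B : 'M[R]_n)
    (x x' : 'cV[R]_n) : Prop :=
  let g := grad f x in
  let Bbar := B + zeta%:M in
  exists (d0 : 'cV[R]_n) (fl0 : direction_flag) (d : 'cV[R]_n)
         (fl : direction_flag) (lam : R),
    [/\ minres Bbar (- g) theta d0 fl0,
        (d, fl) = safeguard g Bbar (Num.min cA (a * enorm g `^ alpha)) d0 fl0,
        stepsize f rho sigma s B x d fl lam
      & x' = x + lam *: d].

(* The method stops at the first k with a vanishing gradient; the terms of x
   after that index are left unconstrained. *)
Definition minres_ls_generates (R : realType) (n : nat) (f : 'cV[R]_n -> R)
    (x0 : 'cV[R]_n) (rho sigma alpha cA s : R) (theta a zeta : nat -> R)
    (B : nat -> 'M[R]_n) (x : nat -> 'cV[R]_n) : Prop :=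
  x 0%N = x0 /\
  forall k, (forall i, (i < k)%N -> grad f (x i) <> 0) ->
    symmetric_mx (B k) /\
    (grad f (x k) <> 0 ->
     minres_ls_step f rho sigma alpha cA s (theta k) (a k) (zeta k) (B k)
       (x k) (x k.+1)).

(* Main.v *)
Require Import Defs.
From mathcomp Require Import all_boot all_order all_algebra.
From mathcomp Require Import all_classical all_reals all_analysis.
From mathcomp Require Import ring lra.
Import Order.TTheory GRing.Theory Num.Theory.
Import numFieldNormedType.Exports.
Local Open Scope classical_set_scope.
Local Open Scope ring_scope.
Set Implicit Arguments.
Unset Strict Implicit.
Unset Printing Implicit Defensive.

(** Near [xs] the Lojasiewicz inequality with exponent 1/2 says that [f - f xs
<= kap^2 |grad f|^2] ([lojasiewicz_half_PL]). Hence any descent scheme whose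
steps are of order [|grad f|] and whose decrease is of order [|grad f|^2]
travels a total distance of order [gap = sqrt (f - f xs)] ([step_le_gap]).
This is used twice.

For gradient descent it gives an error bound: every [x] near [xs] has a
minimizer [x'] with [|x - x'| = O(|grad f x|)] ([gd_error_bound]). As the
Hessian is positive semidefinite at [x'] and Lipschitz, its negative curvature
at [x] is [O(|grad f x|)], and [grad f x] is, to second order, its image of [x
- x'] ([local_geometry]).

The weights [z k] tend to infinity and [zexp <= 1], so the regularization
[zeta k] dominates any multiple of [|grad f (x k)|] once [k] is large and [x
k] is near [xs]. Then the regularized Hessian is positive definite: MINRES
ends with an approximate solution [d], the safeguard accepts it, [|d| =
O(|grad f (x k)|)] independently of the conditioning ([direction_le]), and [d]
makes an acute angle with its residual ([minres_iterate_residual_ge0]). The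
last fact makes the quadratic model decrease by at least half of the slope
([model_le]), so the unit step passes the Armijo test, with a decrease of
order [|grad f (x k)|^2] ([newton_step]).

So once an iterate with a large index is close to its accumulation point [xs],
the sequence stays there ([trapped]) and [gap] contracts geometrically
([gap_contract]). Each step moreover satisfies [|grad f (x k.+1)| = O(zeta k
|grad f (x k)|)], that is [O(z k |grad f (x k)|^(1 + zexp))]; because [z k]
grows subexponentially, the geometric decrease absorbs it at the price of an
arbitrarily small loss in the exponent ([superlinear_rate]). *)

(** * Euclidean norm *)

Section Euclid.
Variables (R : realType) (n : nat).
Implicit Types (u v w : 'cV[R]_n) (M : 'M[R]_n) (a : R).

Lemma edotE u v : edot u v = (u^T *m v) 0 0.
Proof. by rewrite mxE; apply: eq_bigr => i _; rewrite mxE. Qed.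

Lemma edotC u v : edot u v = edot v u.
Proof. by apply: eq_bigr => i _; rewrite mulrC. Qed.

Lemma edotDr u v w : edot u (v + w) = edot u v + edot u w.
Proof. by rewrite !edotE mulmxDr mxE. Qed.

Lemma edotZr a u v : edot u (a *: v) = a * edot u v.
Proof. by rewrite !edotE -scalemxAr mxE. Qed.

Lemma edotNr u v : edot u (- v) = - edot u v.
Proof. by rewrite -scaleN1r edotZr mulN1r. Qed.

Lemma edotBr u v w : edot u (v - w) = edot u v - edot u w.
Proof. by rewrite edotDr edotNr. Qed.

Lemma edotDl u v w : edot (v + w) u = edot v u + edot w u.
Proof. by rewrite ![edot _ u]edotC edotDr. Qed.

Lemma edotZl a u v : edot (a *: v) u = a * edot v u.
Proof. by rewrite ![edot _ u]edotC edotZr. Qed.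

Lemma edotBl u v w : edot (v - w) u = edot v u - edot w u.
Proof. by rewrite ![edot _ u]edotC edotBr. Qed.

Lemma edot0r u : edot u 0 = 0.
Proof. by rewrite -(scale0r 0) edotZr mul0r. Qed.

Lemma edot_trmx M u v : edot u (M *m v) = edot (M^T *m u) v.
Proof. by rewrite !edotE trmx_mul trmxK mulmxA. Qed.

Lemma edot_ge0 u : 0 <= edot u u.
Proof. by apply: sumr_ge0 => i _; rewrite -expr2 sqr_ge0. Qed.

Lemma edot_eq0 u : (edot u u == 0) = (u == 0).
Proof.
apply/eqP/eqP => [u0|->]; last by rewrite edot0r.
apply/colP => i; rewrite mxE; apply/eqP.
have /(_ i isT) := psumr_eq0P (fun i _ => sqr_ge0 (u i 0)) u0.
by move=> /eqP; rewrite sqrf_eq0.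
Qed.

Lemma edot_gt0 u : u != 0 -> 0 < edot u u.
Proof. by move=> u0; rewrite lt_neqAle eq_sym edot_eq0 u0 edot_ge0. Qed.

Lemma enorm_ge0 u : 0 <= enorm u.
Proof. exact: sqrtr_ge0. Qed.

Lemma sqr_enorm u : enorm u ^+ 2 = edot u u.
Proof. by rewrite sqr_sqrtr ?edot_ge0. Qed.

Lemma enorm_eq0 u : (enorm u == 0) = (u == 0).
Proof. by rewrite -sqrf_eq0 sqr_enorm edot_eq0. Qed.

Lemma enorm_gt0 u : (0 < enorm u) = (u != 0).
Proof. by rewrite lt_neqAle eq_sym enorm_eq0 enorm_ge0 andbT. Qed.

Lemma enorm0 : enorm (0 : 'cV[R]_n) = 0.
Proof. by apply/eqP; rewrite enorm_eq0. Qed.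

Lemma enormZ a u : enorm (a *: u) = `|a| * enorm u.
Proof.
by rewrite /enorm edotZl edotZr mulrA -expr2 sqrtrM ?sqr_ge0// sqrtr_sqr.
Qed.

Lemma enormN u : enorm (- u) = enorm u.
Proof. by rewrite -scaleN1r enormZ normrN1 mul1r. Qed.

Lemma enormBC u v : enorm (u - v) = enorm (v - u).
Proof. by rewrite -opprB enormN. Qed.

Lemma edot_le_enorm u v : edot u v <= enorm u * enorm v.
Proof.
have [->|v0] := eqVneq v 0; first by rewrite edot0r enorm0 mulr0.
have [->|u0] := eqVneq u 0; first by rewrite edotC edot0r enorm0 mul0r.
have un : 0 < enorm u by rewrite enorm_gt0.
have vn : 0 < enorm v by rewrite enorm_gt0.
have := edot_ge0 (enorm v *: u - enorm u *: v).
rewrite !(edotBl, edotBr, edotZl, edotZr) -!sqr_enorm [edot v u]edotC.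
rewrite [X in 0 <= X](_ : _ =
  2 * (enorm u * enorm v) * (enorm u * enorm v - edot u v)); last by ring.
by rewrite pmulr_rge0 ?subr_ge0// !mulr_gt0.
Qed.

Lemma ler_enormD u v : enorm (u + v) <= enorm u + enorm v.
Proof.
rewrite -(@ler_pXn2r _ 2) ?nnegrE ?addr_ge0 ?enorm_ge0//.
rewrite sqrrD !sqr_enorm !(edotDl, edotDr) [edot v u]edotC.
by have := edot_le_enorm u v; lra.
Qed.

Lemma ler_enormB u v : enorm (u - v) <= enorm u + enorm v.
Proof. by rewrite -[enorm v]enormN ler_enormD. Qed.

Lemma mx_norm_le_enorm u : `|u| <= enorm u.
Proof.
rewrite -[leLHS]/(mx_norm u) mx_normrE; apply/bigmax_leP.
split; first exact: enorm_ge0.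
move=> [i j] _ /=; rewrite ord1.
rewrite -(@ler_pXn2r _ 2) ?nnegrE ?enorm_ge0// real_normK ?num_real//.
rewrite sqr_enorm /edot (bigD1 i)//= -expr2 lerDl.
by apply: sumr_ge0 => k _; rewrite -expr2 sqr_ge0.
Qed.

Lemma enorm_le_mx_norm u : enorm u <= n.+1%:R * `|u|.
Proof.
have N0 : (0 : R) <= n.+1%:R by [].
rewrite -(@ler_pXn2r _ 2) ?nnegrE ?enorm_ge0 ?mulr_ge0//.
rewrite sqr_enorm exprMn.
apply: (@le_trans _ _ (\sum_(i < n) `|u| ^+ 2)).
  apply: ler_sum => i _; rewrite -expr2 -real_normK ?num_real//.
  rewrite ler_pXn2r ?nnegrE// -[leRHS]/(mx_norm u) mx_normrE.
  exact: (le_bigmax _ (fun k : 'I_n * 'I_1 => `|u k.1 k.2|) (i, 0)).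
rewrite sumr_const card_ord -[leLHS]mulr_natl ler_wpM2r ?sqr_ge0//.
by rewrite -natrX ler_nat (leq_trans (leqnSn n))// leq_pmulr.
Qed.

(** All quantitative estimates live on Euclidean balls; this is the bridge to
the sup-norm topology. *)
Lemma nbhs_enormP (x : 'cV[R]_n) (P : set 'cV[R]_n) :
  nbhs x P <-> exists2 r : R, 0 < r & forall y, enorm (y - x) < r -> P y.
Proof.
split=> [/nbhs_ballP[r r0 rP]|[r r0 rP]].
  exists r => // y yx; apply: rP; rewrite -ball_normE /=.
  by rewrite -normrN opprB (le_lt_trans (mx_norm_le_enorm _)).
apply/nbhs_ballP; exists (r / n.+1%:R); first by rewrite /= divr_gt0.
move=> y; rewrite -ball_normE /= => yx; apply: rP.
rewrite (le_lt_trans (enorm_le_mx_norm _))// -normrN opprB.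
by rewrite mulrC -ltr_pdivlMr.
Qed.

Lemma mulmx_bounded M :
  exists2 C : R, 0 < C & forall v, enorm (M *m v) <= C * enorm v.
Proof.
pose c (j : 'I_n) := enorm (col j M).
exists (1 + \sum_j c j).
  by rewrite ltr_pwDl// sumr_ge0// => j _; apply: enorm_ge0.
move=> v.
have -> : M *m v = \sum_j v j 0 *: col j M.
  apply/colP => i; rewrite summxE mxE; apply: eq_bigr => j _.
  by rewrite !mxE mulrC.
apply: (@le_trans _ _ (\sum_j c j * enorm v)).
  apply: (big_ind2 (fun (a : 'cV[R]_n) b => enorm a <= b)).
  - by rewrite enorm0.
  - by move=> a b a' b' ab ab'; rewrite (le_trans (ler_enormD _ _))// lerD.
  - move=> j _; rewrite enormZ mulrC ler_wpM2l ?enorm_ge0//.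
    apply: le_trans (mx_norm_le_enorm v).
    rewrite -[leRHS]/(mx_norm v) mx_normrE.
    exact: (le_bigmax _ (fun k : 'I_n * 'I_1 => `|v k.1 k.2|) (j, 0)).
by rewrite -mulr_suml ler_wpM2r ?enorm_ge0// lerDr.
Qed.

(** Boundedness of the linear map is what rules out a junk value of the
supremum in [specnorm]. *)
Lemma enorm_mulmx M v : enorm (M *m v) <= specnorm M * enorm v.
Proof.
have [->|v0] := eqVneq v 0; first by rewrite mulmx0 enorm0 mulr0.
have vn : 0 < enorm v by rewrite enorm_gt0.
rewrite -ler_pdivrMr// mulrC.
have -> : (enorm v)^-1 * enorm (M *m v) = enorm (M *m ((enorm v)^-1 *: v)).
  by rewrite -scalemxAr enormZ gtr0_norm ?invr_gt0.
have [C C0 MC] := mulmx_bounded M.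
apply: ub_le_sup.
  exists C => _ [w w1 <-]; rewrite (le_trans (MC w))// -[leRHS]mulr1.
  by rewrite ler_wpM2l// ltW.
exists ((enorm v)^-1 *: v) => //=.
by rewrite enormZ gtr0_norm ?invr_gt0// mulVf// gt_eqF.
Qed.

End Euclid.

(** * Derivatives along lines *)

Section Taylor.
Variables (R : realType) (n : nat).
Implicit Types (x y d v w : 'cV[R]_n) (t : R).

Lemma colE_sum v : v = \sum_(i < n) v i 0 *: delta_mx i 0.
Proof.
apply/colP => j; rewrite summxE (bigD1 j)//= big1 => [|i ij].
  by rewrite !mxE !eqxx mulr1 addr0.
by rewrite !mxE eq_sym (negPf ij) mulr0.
Qed.

Lemma derive_gradE (f : 'cV[R]_n -> R) x v :
  differentiable f x -> 'D_v f x = edot (grad f x) v.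
Proof.
move=> df; rewrite deriveE// {1}(colE_sum v) linear_sum.
by apply: eq_bigr => i _; rewrite linearZ !mxE deriveE// mulrC.
Qed.

(** The transpose comes from the index convention of [hess]: row [i] collects
the partial derivatives in the direction [e_i]. *)
Lemma derive_hessE (f : 'cV[R]_n -> R) x v :
  differentiable (grad f) x -> 'D_v (grad f) x = (hess f x)^T *m v.
Proof.
move=> df; rewrite deriveE// {1}(colE_sum v) linear_sum.
apply/colP => j; rewrite summxE mxE.
by apply: eq_bigr => i _; rewrite linearZ !mxE deriveE// mulrC.
Qed.

Lemma continuous_edot w : continuous (edot w : 'cV[R]_n -> R).
Proof.
move=> x; apply/(@cvgrPdist_lt _ R^o _ (nbhs x)) => e e0; apply/nbhs_enormP.
have w1 : 0 < 1 + enorm w by rewrite ltr_pwDl// enorm_ge0.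
exists (e / (1 + enorm w)); first by rewrite divr_gt0.
move=> y; rewrite ltr_pdivlMr// => yx.
have lew z : edot w z <= enorm z * (1 + enorm w).
  rewrite (le_trans (edot_le_enorm _ _))// mulrC ler_wpM2l ?enorm_ge0//.
  by rewrite lerDr.
rewrite -edotBr ltr_norml ltrNl -edotNr opprB (le_lt_trans (lew _))//=.
by rewrite (le_lt_trans (lew _))// enormBC.
Qed.

(** The difference quotient along the line is literally the one that defines
the directional derivative, so no chain rule is involved. *)
Lemma is_derive_line (f : 'cV[R]_n -> R) x d t :
  differentiable f (x + t *: d) ->
  is_derive t 1 (fun t => f (x + t *: d)) (edot (grad f (x + t *: d)) d).
Proof.
move=> df; have dv := @diff_derivable _ _ _ _ _ d df.
have E : (fun h => h^-1 *: (((fun t => f (x + t *: d)) \o shift t) (h *: 1)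
                            - f (x + t *: d)))
       = (fun h => h^-1 *: ((f \o shift (x + t *: d)) (h *: d)
                            - f (x + t *: d))).
  apply/funext => h /=; congr (_ *: (f _ - _)).
  by rewrite -[h *: 1]/(h * 1) mulr1 scalerDl addrCA.
split; first by rewrite /derivable E.
by rewrite -derive_gradE// /derive E.
Qed.

Lemma is_derive_grad_line (f : 'cV[R]_n -> R) x d w t :
  differentiable (grad f) (x + t *: d) ->
  is_derive t 1 (fun t => edot w (grad f (x + t *: d)))
    (edot w ((hess f (x + t *: d))^T *m d)).
Proof.
move=> df; have /= dv := @diff_derivable _ _ _ _ _ d df.
have E : (fun h => h^-1 *: (((fun t => edot w (grad f (x + t *: d)))
                             \o shift t) (h *: 1)
                            - edot w (grad f (x + t *: d))))
       = edot w \o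
         (fun h => h^-1 *: ((grad f \o shift (x + t *: d)) (h *: d)
                            - grad f (x + t *: d))).
  apply/funext => h /=; rewrite edotZr edotBr.
  congr (_ * (edot w (grad f _) - _)).
  by rewrite -[h *: 1]/(h * 1) mulr1 scalerDl addrCA.
have cv : (edot w \o (fun h => h^-1 *: ((grad f \o shift (x + t *: d)) (h *: d)
      - grad f (x + t *: d)))) h @[h --> 0^'] -->
      edot w ((hess f (x + t *: d))^T *m d).
  rewrite -derive_hessE//; apply: continuous_cvg; first exact: continuous_edot.
  exact: dv.
split; first by rewrite /derivable E; apply/cvg_ex; eexists; exact: cv.
by rewrite /derive E; exact/cvg_lim.
Qed.

Lemma MVT_derive (h dh : R -> R) :
  (forall t, is_derive t 1 h (dh t)) ->
  exists2 c, 0 <= c <= 1 & h 1 - h 0 = dh c.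
Proof.
move=> dhE.
have h_cont : {within `[0, 1], continuous h}.
  apply: continuous_subspaceT => t; apply: differentiable_continuous.
  exact/derivable1_diffP/ex_derive.
have [c c01 ->] := @MVT _ h dh 0 1 ltr01 (fun t _ => dhE t) h_cont.
exists c; last by rewrite subr0 mulr1.
by move: c01; rewrite in_itv/= => /andP[? ?]; rewrite !ltW.
Qed.

End Taylor.

(** * The local model of the objective *)

Section LocalModel.
Variables (R : realType) (n : nat) (f : 'cV[R]_n -> R) (xs : 'cV[R]_n).
Variables (D L : R).
Hypothesis df : forall x : 'cV[R]_n, differentiable f x.
Hypothesis dg : forall x : 'cV[R]_n, differentiable (grad f) x.
Hypothesis D0 : 0 < D.
Hypothesis L0 : 0 <= L.
Hypothesis hess_lip : forall y z v : 'cV[R]_n,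
  enorm (y - xs) < D -> enorm (z - xs) < D ->
  enorm (((hess f y)^T - (hess f z)^T) *m v) <= L * enorm (y - z) * enorm v.
Implicit Types (x y d v : 'cV[R]_n).

Let g := grad f.
Let H y := (hess f y)^T.

Lemma segment_in_ball y d (c r : R) : 0 <= c <= 1 ->
  enorm (y - xs) < r -> enorm (y + d - xs) < r -> enorm (y + c *: d - xs) < r.
Proof.
move=> /andP[c0 c1] yr ydr.
have -> : y + c *: d - xs = (1 - c) *: (y - xs) + c *: (y + d - xs).
  by apply/colP => i; rewrite !mxE; ring.
rewrite (le_lt_trans (ler_enormD _ _))// !enormZ !ger0_norm ?subr_ge0//.
have [->|c_neq0] := eqVneq c 0; first by rewrite subr0 mul1r mul0r addr0.
have cgt0 : 0 < c by rewrite lt_neqAle eq_sym c_neq0.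
have : (1 - c) * enorm (y - xs) <= (1 - c) * r.
  by rewrite ler_wpM2l ?subr_ge0// ltW.
have : c * enorm (y + d - xs) < c * r by rewrite ltr_pM2l.
lra.
Qed.

(** The mean value theorem holds for scalar functions only, so it is applied
to [t => w . grad f (y + t d)], where [w] is the remainder to be bounded. *)
Lemma grad_taylor y d : enorm (y - xs) < D -> enorm (y + d - xs) < D ->
  enorm (g (y + d) - g y - H y *m d) <= L * enorm d ^+ 2.
Proof.
move=> yD ydD; move wE: (_ - _ - _) => w.
have [c c01] := MVT_derive (fun t => @is_derive_grad_line _ _ f y d w t (dg _)).
rewrite scale1r scale0r addr0 -edotBr => mvt.
have [->|w0] := eqVneq w 0; first by rewrite enorm0 mulr_ge0// sqr_ge0.
rewrite -(@ler_pM2l _ (enorm w)) ?enorm_gt0// -[leLHS]expr2 [leLHS]sqr_enorm.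
have {1}-> : edot w w = edot w ((H (y + c *: d) - H y) *m d).
  by rewrite -[X in edot _ X]wE mulmxBl edotBr mvt edotBr.
rewrite (le_trans (edot_le_enorm _ _))// ler_wpM2l ?enorm_ge0//.
rewrite (le_trans (hess_lip _ _ _))//; first exact: segment_in_ball.
rewrite addrC addKr enormZ expr2 mulrA ler_wpM2r ?enorm_ge0// ler_wpM2l//.
case/andP: c01 => c0 c1.
by rewrite ger0_norm// ler_piMl ?enorm_ge0.
Qed.

(** The mean value theorem applied to [f] minus its quadratic model along the
segment: the derivative of the difference is the remainder of [grad_taylor].
The constant is not sharp; only the order of the remainder matters. *)
Lemma taylor2 y d : enorm (y - xs) < D -> enorm (y + d - xs) < D ->
  f (y + d) - f y <= edot (g y) d + 2^-1 * edot d (H y *m d) + L * enorm d ^+ 3.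
Proof.
move=> yD ydD.
pose h t := f (y + t *: d) -
  (t * edot (g y) d + t ^+ 2 * (2^-1 * edot d (H y *m d))).
pose dh t := edot (g (y + t *: d)) d - (edot (g y) d + t * edot d (H y *m d)).
have hdh (t : R) : is_derive t 1 h (dh t).
  have h1 := @is_derive_line _ _ f y d t (df _).
  have h2 : is_derive t 1
      (fun t => t * edot (g y) d + t ^+ 2 * (2^-1 * edot d (H y *m d)))
      (edot (g y) d + t * edot d (H y *m d)).
    apply: is_derive_eq.
    rewrite /GRing.scale/=. by lra.
  exact: (@is_deriveB _ _ _ _ _ t 1 _ _ h1 h2).
have [c c01] := MVT_derive hdh.
rewrite /h /dh !scale1r !scale0r !addr0 mul0r expr0n mul0r addr0 subr0.
rewrite mul1r expr1n mul1r => E.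
have ycD := segment_in_ball c01 yD ydD.
have := edot_le_enorm (g (y + c *: d) - g y - H y *m (c *: d)) d.
rewrite -scalemxAr !edotBl edotZl [edot (H y *m d) d]edotC => E2.
have := ler_wpM2r (enorm_ge0 d) (grad_taylor yD ycD).
rewrite -scalemxAr => E3.
suff : L * enorm (c *: d) ^+ 2 * enorm d <= L * enorm d ^+ 3.
  by rewrite /g in E2 E3 *; lra.
case/andP: c01 => c0 c1.
rewrite -mulrA ler_wpM2l// [leRHS]exprSr ler_wpM2r ?enorm_ge0// enormZ ger0_norm//.
by rewrite ler_pXn2r ?nnegrE ?mulr_ge0 ?enorm_ge0// ler_piMl ?enorm_ge0.
Qed.

Lemma hess_bounded : exists2 M : R, 0 < M &
  forall y v, enorm (y - xs) < D -> enorm (H y *m v) <= M * enorm v.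
Proof.
have [C C0 HC] := mulmx_bounded (H xs).
exists (C + L * D); first by rewrite ltr_pwDl// mulr_ge0// ltW.
move=> y v yD.
have -> : H y *m v = H xs *m v + (H y - H xs) *m v.
  by rewrite mulmxBl addrC subrK.
rewrite (le_trans (ler_enormD _ _))// mulrDl lerD//.
rewrite (le_trans (hess_lip _ _ _))// ?subrr ?enorm0//.
by rewrite ler_wpM2r ?enorm_ge0// ler_wpM2l// ltW.
Qed.

Section HessBound.
Variable M : R.
Hypothesis hess_le : forall y v,
  enorm (y - xs) < D -> enorm (H y *m v) <= M * enorm v.

Lemma grad_lip y d : enorm (y - xs) < D -> enorm (y + d - xs) < D ->
  enorm (g (y + d) - g y) <= M * enorm d.
Proof.
move=> yD ydD; move wE: (_ - _) => w.
have [c c01] := MVT_derive (fun t => @is_derive_grad_line _ _ f y d w t (dg _)).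
rewrite scale1r scale0r addr0 -edotBr wE => mvt.
have [->|w0] := eqVneq w 0.
  by rewrite enorm0 (le_trans _ (hess_le _ yD))// enorm_ge0.
rewrite -(@ler_pM2l _ (enorm w)) ?enorm_gt0// -[leLHS]expr2 [leLHS]sqr_enorm.
rewrite mvt (le_trans (edot_le_enorm _ _))// ler_wpM2l ?enorm_ge0//.
by rewrite hess_le//; exact: segment_in_ball.
Qed.

Lemma taylor1 y d : enorm (y - xs) < D -> enorm (y + d - xs) < D ->
  f (y + d) - f y <= edot (g y) d + M * enorm d ^+ 2.
Proof.
move=> yD ydD.
have [c c01] := MVT_derive (fun t => @is_derive_line _ _ f y d t (df _)).
rewrite scale1r scale0r addr0 => ->.
rewrite -lerBlDl -edotBl (le_trans (edot_le_enorm _ _))//.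
rewrite expr2 mulrA ler_wpM2r ?enorm_ge0//.
rewrite (le_trans (grad_lip yD (segment_in_ball c01 yD ydD)))//.
have M0 : 0 <= M * enorm d by rewrite (le_trans _ (hess_le _ yD))// enorm_ge0.
case/andP: c01 => c0 c1.
by rewrite enormZ ger0_norm// mulrCA ler_piMl.
Qed.

End HessBound.

(** * Descent under the Polyak-Lojasiewicz inequality *)

(** The square root turns the Polyak-Lojasiewicz inequality into a slope
condition: where [f] is above its minimum, [gap] decreases at a rate bounded
away from 0. *)
Definition gap y := Num.sqrt (f y - f xs).

Variable kap : R.
Hypothesis kap0 : 0 < kap.
Hypothesis fmin : forall y, enorm (y - xs) < D -> f xs <= f y.
Hypothesis PL : forall y, enorm (y - xs) < D ->
  f y - f xs <= (kap * enorm (g y)) ^+ 2.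

(** A step proportional to the gradient that achieves a proportional squared
decrease is paid for by the decrease of [gap]: factor the decrease of [f] as
[(gap y - gap y') (gap y + gap y')] and bound the sum by [2 kap |grad f y|].
*)
Lemma step_le_gap (c C : R) y y' : 0 < c -> 0 <= C ->
  enorm (y - xs) < D -> enorm (y' - xs) < D ->
  enorm (y' - y) <= C * enorm (g y) ->
  f y' <= f y - c * enorm (g y) ^+ 2 ->
  enorm (y' - y) <= 2 * kap * C / c * (gap y - gap y').
Proof.
move=> c0 C0 yD y'D yy' fyy'.
have p'0 : 0 <= f y' - f xs by rewrite subr_ge0 fmin.
have p0 : 0 <= f y - f xs by rewrite subr_ge0 fmin.
have gap'0 : 0 <= gap y' := sqrtr_ge0 _.
have gap'E : gap y' ^+ 2 = f y' - f xs by rewrite sqr_sqrtr.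
have gapE : gap y ^+ 2 = f y - f xs by rewrite sqr_sqrtr.
have G0 : 0 <= enorm (g y) := enorm_ge0 _.
have gap_le : gap y <= kap * enorm (g y).
  rewrite -(@ler_pXn2r _ 2) ?nnegrE ?sqrtr_ge0 ?mulr_ge0 ?(ltW kap0)//.
  by rewrite gapE PL.
have gap_dec : gap y' <= gap y.
  rewrite ler_sqrt// lerB// (le_trans fyy')// gerBl.
  by rewrite mulr_ge0 ?sqr_ge0// ltW.
suff key : c * enorm (g y) <= 2 * kap * (gap y - gap y').
  rewrite (le_trans yy')//.
  have -> : 2 * kap * C / c * (gap y - gap y')
    = C * (c^-1 * (2 * kap * (gap y - gap y'))) by ring.
  by rewrite ler_wpM2l// ler_pdivlMl.
have [->|Gneq0] := eqVneq (enorm (g y)) 0.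
  by rewrite mulr0 !mulr_ge0 ?subr_ge0// ltW.
have Gpos : 0 < enorm (g y) by rewrite lt_neqAle eq_sym Gneq0.
rewrite -(@ler_pM2r _ (enorm (g y)))//.
have : c * enorm (g y) ^+ 2 <= (gap y - gap y') * (gap y + gap y').
  by rewrite [leRHS](_ : _ = gap y ^+ 2 - gap y' ^+ 2); [lra|ring].
have : (gap y - gap y') * (gap y + gap y') <=
    (gap y - gap y') * (2 * (kap * enorm (g y))).
  by rewrite ler_wpM2l ?subr_ge0//; lra.
lra.
Qed.

(** The quantity [|x - xs| + K * gap x] does not increase along such a
sequence, by [step_le_gap]; so a sequence that starts close enough never
leaves. *)
Lemma trapped (x : nat -> 'cV[R]_n) (N : nat) (r c C : R) :
  0 < c -> 0 <= C -> r <= D ->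
  (forall k, (N <= k)%N -> enorm (x k - xs) < r ->
    [/\ enorm (x k.+1 - xs) < D,
        enorm (x k.+1 - x k) <= C * enorm (g (x k))
      & f (x k.+1) <= f (x k) - c * enorm (g (x k)) ^+ 2]) ->
  enorm (x N - xs) + 2 * kap * C / c * gap (x N) < r ->
  forall k, (N <= k)%N -> enorm (x k - xs) < r.
Proof.
move=> c0 C0 rD step; set K := 2 * kap * C / c => start k Nk.
have K0 : 0 <= K by rewrite divr_ge0 ?mulr_ge0// ltW.
suff : enorm (x k - xs) + K * gap (x k) < r.
  by apply: le_lt_trans; rewrite lerDl mulr_ge0// sqrtr_ge0.
rewrite -(subnKC Nk); elim: (k - N)%N => [|j IH]; first by rewrite addn0.
rewrite addnS; set i := (N + j)%N in IH *.
have xr : enorm (x i - xs) < r.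
  by rewrite (le_lt_trans _ IH)// lerDl mulr_ge0// sqrtr_ge0.
have [x'D xx' fxx'] := step i (leq_addr _ _) xr.
have := step_le_gap c0 C0 (lt_le_trans xr rD) x'D xx' fxx'; rewrite -/K.
have := ler_enormD (x i.+1 - x i) (x i - xs); rewrite addrA subrK.
by move: IH; lra.
Qed.

Lemma gap_contract (c : R) y y' : 0 < c -> c < kap ^+ 2 ->
  enorm (y - xs) < D -> enorm (y' - xs) < D ->
  f y' <= f y - c * enorm (g y) ^+ 2 ->
  gap y' <= Num.sqrt (1 - c / kap ^+ 2) * gap y.
Proof.
move=> c0 ck yD y'D dec; have k20 : 0 < kap ^+ 2 by rewrite exprn_gt0.
have ck1 : 0 <= 1 - c / kap ^+ 2 by rewrite subr_ge0 ler_pdivrMr ?mul1r// ltW.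
rewrite /gap -sqrtrM// ler_sqrt; last by rewrite mulr_ge0// subr_ge0 fmin.
have : c / kap ^+ 2 * (f y - f xs) <= c * enorm (g y) ^+ 2.
  rewrite -mulrA ler_wpM2l ?(ltW c0)// ler_pdivrMl//.
  by rewrite -exprMn PL.
by move: dec; lra.
Qed.

Lemma grad_le_gap (c : R) y y' : 0 < c ->
  enorm (y' - xs) < D -> f y' <= f y - c * enorm (g y) ^+ 2 ->
  enorm (g y) <= Num.sqrt c^-1 * gap y.
Proof.
move=> c0 y'D dec; have le : enorm (g y) ^+ 2 <= c^-1 * (f y - f xs).
  by rewrite ler_pdivlMl//; move: dec (fmin y'D); lra.
rewrite /gap -sqrtrM ?invr_ge0 ?(ltW c0)//.
by rewrite -[leLHS](ger0_norm (enorm_ge0 _)) -sqrtr_sqr ler_wsqrtr.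
Qed.

(** * Gradient descent and the error bound *)

Section GradientDescent.
Variable M : R.
Hypothesis M0 : 0 < M.
Hypothesis hess_le : forall y v,
  enorm (y - xs) < D -> enorm (H y *m v) <= M * enorm v.

Let xsD : enorm (xs - xs) < D. Proof. by rewrite subrr enorm0. Qed.

(** Otherwise a short gradient step would go below the minimum value. *)
Lemma grad_min0 : g xs = 0.
Proof.
pose G := enorm (g xs); have G0 : 0 <= G := enorm_ge0 _.
pose t := Num.min (2 * M)^-1 (D / (2 * (1 + G))).
have t0 : 0 < t.
  rewrite lt_min invr_gt0; apply/andP; split; first by rewrite mulr_gt0.
  by rewrite divr_gt0// mulr_gt0// ltr_pwDl.
have tM : t * M <= 2^-1.
  have : t <= (2 * M)^-1 by rewrite ge_min lexx.
  by move=> /(ler_wpM2r (ltW M0)); rewrite invfM mulfVK// gt_eqF.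
have tG : t * G < D.
  have tD : t <= D / (2 * (1 + G)) by rewrite ge_min lexx orbT.
  rewrite (le_lt_trans (ler_wpM2r G0 tD))// mulrAC ltr_pdivrMr.
    by rewrite ltr_pM2l//; lra.
  by rewrite mulr_gt0// ltr_pwDl.
have tB : enorm (xs + (- t) *: g xs - xs) < D.
  by rewrite addrC addKr enormZ normrN gtr0_norm.
have := taylor1 hess_le xsD tB.
rewrite edotZr -sqr_enorm enormZ normrN gtr0_norm// -/G => T.
have F := fmin tB.
apply/eqP; rewrite -enorm_eq0 -/G -sqrf_eq0.
rewrite eq_le sqr_ge0 andbT -(pmulr_rle0 _ t0).
have : t * M * (t * G ^+ 2) <= 2^-1 * (t * G ^+ 2).
  by rewrite ler_wpM2r// mulr_ge0 ?sqr_ge0// ltW.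
rewrite exprMn in T; lra.
Qed.

Lemma grad_le y : enorm (y - xs) < D -> enorm (g y) <= M * enorm (y - xs).
Proof.
move=> yD; have := grad_lip hess_le xsD (_ : enorm (xs + (y - xs) - xs) < D).
by rewrite grad_min0 subr0 subrKC; apply.
Qed.

Lemma gap_le y : enorm (y - xs) < D -> gap y <= kap * M * enorm (y - xs).
Proof.
move=> yD; rewrite -(@ler_pXn2r _ 2) ?nnegrE ?sqrtr_ge0//; last first.
  by rewrite !mulr_ge0 ?enorm_ge0// ltW.
rewrite sqr_sqrtr ?subr_ge0 ?fmin// (le_trans (PL yD))//.
rewrite ler_pXn2r ?nnegrE ?mulr_ge0 ?enorm_ge0 ?(ltW kap0) ?(ltW M0)//.
by rewrite -mulrA ler_wpM2l ?grad_le// ltW.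
Qed.

Let gd y := y - (2 * M)^-1 *: g y.

(** The step [1 / (2 M)] is short enough for half of the first order decrease
to survive, and to stay in the ball since the gradient is [M]-Lipschitz. *)
Lemma gd_step y : enorm (y - xs) < D / 2 ->
  [/\ enorm (gd y - xs) < D, enorm (gd y - y) = (2 * M)^-1 * enorm (g y)
   & f (gd y) <= f y - (4 * M)^-1 * enorm (g y) ^+ 2].
Proof.
move=> yD2; have yD : enorm (y - xs) < D.
  by rewrite (lt_trans yD2)// ltr_pdivrMr// ltr_pMr// ltr1n.
have tau0 : 0 < (2 * M)^-1 by rewrite invr_gt0 mulr_gt0.
have stepE : enorm (gd y - y) = (2 * M)^-1 * enorm (g y).
  by rewrite /gd addrC addKr enormN enormZ gtr0_norm.
have gdD : enorm (gd y - xs) < D.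
  rewrite -[gd y](subrK y) -addrA (le_lt_trans (ler_enormD _ _))// stepE.
  have := grad_le yD; rewrite -(ler_pM2l tau0) invfM -!mulrA mulKf ?gt_eqF//.
  lra.
split=> //; have := taylor1 hess_le yD gdD.
rewrite edotNr edotZr -sqr_enorm enormN enormZ gtr0_norm// -/(gd y) exprMn.
rewrite [X in _ <= X](_ : _ = - ((4 * M)^-1 * enorm (g y) ^+ 2)); first by lra.
by field; rewrite gt_eqF.
Qed.

(** Error bound: gradient descent started at [x] has length at most a multiple
of [gap x], which the Polyak-Lojasiewicz inequality bounds by the gradient at
[x]; its limit is a minimizer, hence one within a distance of order [|grad f
x|]. *)
Lemma gd_error_bound x :
  enorm (x - xs) + 4 * kap * gap x < D / 2 ->
  exists x', [/\ enorm (x' - xs) < D, f x' = f xs, g x' = 0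
    & enorm (x' - x) <= 4 * kap ^+ 2 * enorm (g x)].
Proof.
set K := 4 * kap => Vx; pose y j : 'cV[R]_n := iter j gd x.
have K0 : 0 <= K by rewrite mulr_ge0// ltW.
have KE : 2 * kap * (2 * M)^-1 / (4 * M)^-1 = K.
  by rewrite /K; field; rewrite gt_eqF.
pose V z := enorm (z - xs) + K * gap z.
have VB z : V z < D / 2 -> enorm (z - xs) < D / 2.
  by apply: le_lt_trans; rewrite lerDl mulr_ge0// sqrtr_ge0.
have B2 z : enorm (z - xs) < D / 2 -> enorm (z - xs) < D by move: D0; lra.
have step z : V z < D / 2 ->
    enorm (gd z - z) <= K * (gap z - gap (gd z)) /\ V (gd z) <= V z.
  move=> /VB zD; have [gdD stepE dec] := gd_step zD.
  have gapstep : enorm (gd z - z) <= K * (gap z - gap (gd z)).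
    rewrite -KE; apply: step_le_gap => //.
    - by rewrite invr_gt0 mulr_gt0.
    - by rewrite invr_ge0 mulr_ge0// ltW.
    - exact: B2.
    - by rewrite stepE.
  split=> //; have := ler_enormD (gd z - z) (z - xs).
  by rewrite addrA subrK /V; lra.
have inv j : V (y j) < D / 2.
  by elim: j => // j IH; rewrite (le_lt_trans _ IH)//; apply: (step _ IH).2.
have incr j : enorm (y j.+1 - y j) <= K * (gap (y j) - gap (y j.+1)).
  exact: (step _ (inv j)).1.
have tele j : enorm (y j - x) <= K * (gap x - gap (y j)).
  elim: j => [|j IH]; first by rewrite !subrr enorm0 mulr0.
  have := ler_enormD (y j.+1 - y j) (y j - x); rewrite addrA subrK.
  by have := incr j; lra.
pose u j : 'cV[R]_n := y j.+1 - y j.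
have su j : series u j = y j - x by rewrite /series /= telescope_sumr.
have cn : cvgn (series (fun j => `|u j|)).
  apply: nondecreasing_is_cvgn.
    by apply: nondecreasing_series => j _ _; exact: normr_ge0.
  exists (K * gap x) => _ [j _ <-]; rewrite /series /=.
  apply: (@le_trans _ _
    (\sum_(0 <= i < j) (- (K * gap (y i.+1)) - - (K * gap (y i))))).
    apply: ler_sum => i _; rewrite (le_trans (mx_norm_le_enorm _))//.
    by rewrite opprK addrC -mulrBr incr.
  rewrite telescope_sumr// opprK addrC lerBlDr lerDl mulr_ge0//.
  exact: sqrtr_ge0.
have cu : cvgn (series u).
  apply/(@cauchy_cvgP 'cV[R]_n)/(@cauchy_seriesP _ 'cV[R]_n) => e.
  move: cn => /(@cauchy_cvgP R)/(@cauchy_seriesP _ R)/[apply].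
  apply: filterS => j /=; rewrite ger0_norm ?sumr_ge0//.
  by apply: le_lt_trans; apply: ler_norm_sum.
have [l yl] : exists l : 'cV[R]_n, (y : nat -> 'cV[R]_n) @ \oo --> l.
  case/cvg_ex: cu => l ul; exists (l + x).
  rewrite [y](_ : _ = (fun j => series u j + x)).
    by apply: cvgD => //; exact: cvg_cst.
  by apply/funext => j; rewrite su subrK.
have near_l e : 0 < e -> exists j, enorm (y j - l) < e.
  move=> e0; have /yl [N _ Ne] : nbhs l [set z | enorm (z - l) < e].
    by apply/nbhs_enormP; exists e.
  by exists N; exact: (Ne N (leqnn N)).
have lx : enorm (l - x) <= K * gap x.
  apply/ler_addgt0Pr => e /near_l [j ej].
  have := ler_enormD (l - y j) (y j - x); rewrite addrA subrK enormBC.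
  have := tele j; have : 0 <= K * gap (y j) by rewrite mulr_ge0// sqrtr_ge0.
  lra.
have lD : enorm (l - xs) < D.
  have := ler_enormD (l - x) (x - xs); rewrite addrA subrK.
  by move: Vx D0; lra.
have gl : g l = 0.
  have c0 : g (y j) @[j --> \oo] --> g l.
    by apply: (cvg_comp y g yl); exact: differentiable_continuous (dg l).
  have c1 : y j.+1 @[j --> \oo] --> l by rewrite cvg_shiftS.
  have c2 : y j - (2 * M)^-1 *: g (y j) @[j --> \oo] --> l - (2 * M)^-1 *: g l.
    by apply: cvgB => //; exact: cvgZl_tmp.
  have E : l = l - (2 * M)^-1 *: g l := norm_cvg_unique c1 c2.
  have z0 : (2 * M)^-1 *: g l = 0.
    by rewrite -[LHS](subKr l) -E subrr.
  have MM : 2 * M != 0 by rewrite mulf_neq0 ?gt_eqF.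
  by rewrite -[LHS]scale1r -(mulfV MM) -scalerA z0 scaler0.
exists l; split=> //.
  apply/eqP; rewrite eq_le fmin// andbT -subr_le0 (le_trans (PL lD))//.
  by rewrite gl enorm0 mulr0 expr0n.
rewrite (le_trans lx)//.
have -> : 4 * kap ^+ 2 * enorm (g x) = K * (kap * enorm (g x)).
  by rewrite /K; ring.
rewrite ler_wpM2l//.
rewrite -(@ler_pXn2r _ 2) ?nnegrE ?sqrtr_ge0 ?mulr_ge0 ?enorm_ge0 ?(ltW kap0)//.
have xD : enorm (x - xs) < D by apply/B2/VB.
by rewrite sqr_sqrtr ?PL// subr_ge0 fmin.
Qed.

(** Second order necessary condition at a minimizer: a direction [v] of
negative curvature would make the quadratic term win over the cubic remainder.
*)
Lemma hess_min_ge0 x v :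
  enorm (x - xs) < D -> f x = f xs -> g x = 0 -> 0 <= edot v (H x *m v).
Proof.
move=> xD fx gx; rewrite leNgt; apply/negP => q0.
set q := edot v (H x *m v) in q0; pose W := enorm v.
have W0 : 0 <= W := enorm_ge0 v.
pose a := L * W ^+ 3; have a0 : 0 <= a by rewrite mulr_ge0// exprn_ge0.
(* The first bound keeps the point in the ball; the second one makes the cubic
   remainder at most half of the quadratic gain. *)
pose t := Num.min ((D - enorm (x - xs)) / (2 * (1 + W))) (- q / (4 * (1 + a))).
have rho0 : 0 < D - enorm (x - xs) by rewrite subr_gt0.
have t0 : 0 < t.
  by rewrite lt_min !divr_gt0 ?oppr_gt0// mulr_gt0// ltr_pwDl.
have tW : t * W < D - enorm (x - xs).
  have tD : t <= (D - enorm (x - xs)) / (2 * (1 + W)) by rewrite ge_min lexx.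
  rewrite (le_lt_trans (ler_wpM2r W0 tD))// mulrAC ltr_pdivrMr.
    by rewrite ltr_pM2l//; lra.
  by rewrite mulr_gt0// ltr_pwDl.
have ta : t * a <= - q / 4.
  have tq : t <= - q / (4 * (1 + a)) by rewrite ge_min lexx orbT.
  rewrite (le_trans (ler_wpM2r a0 tq))//.
  rewrite [leLHS](_ : _ = (- q / 4) * (a / (1 + a))); last first.
    by field; rewrite gt_eqF// ltr_pwDl.
  rewrite ler_piMr ?divr_ge0 ?oppr_ge0 ?(ltW q0)//.
  by rewrite ler_pdivrMr ?mul1r; lra.
have tB : enorm (x + t *: v - xs) < D.
  rewrite addrAC (le_lt_trans (ler_enormD _ _))// enormZ gtr0_norm//.
  by move: tW; rewrite -/W; lra.
have := taylor2 xD tB; have := fmin tB.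
rewrite gx fx edotC edot0r add0r -scalemxAr edotZl edotZr enormZ gtr0_norm//.
rewrite -/q -/W => F T.
have {F T} : 0 <= t ^+ 2 * (q / 2 + t * a).
  rewrite [X in _ <= X](_ : _ = 2^-1 * (t * (t * q)) + L * (t * W) ^+ 3).
    by move: F T; lra.
  by rewrite /a; field.
rewrite pmulr_rge0 ?exprn_gt0//.
by move: ta q0; lra.
Qed.

(** Comparison with the nearby minimizer [x'] of [gd_error_bound], with [e = x
- x']: the gradient is, to second order, the image of [e] under the Hessian,
and the curvature at [x] is at worst that at [x'], which is nonnegative, minus
a multiple of [|x - x'|]. *)
Lemma local_geometry x : enorm (x - xs) * (1 + 4 * kap ^+ 2 * M) < D / 2 ->
  exists e, [/\ enorm e <= 4 * kap ^+ 2 * enorm (g x),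
    enorm (H x *m e - g x) <= L * enorm e ^+ 2 &
    forall v, - (L * (4 * kap ^+ 2 * enorm (g x))) * enorm v ^+ 2
              <= edot v (H x *m v)].
Proof.
move=> xr.
have k2M : 0 <= 4 * kap ^+ 2 * M by rewrite !mulr_ge0 ?exprn_ge0 ?ltW.
have xD : enorm (x - xs) < D.
  have := mulr_ge0 (enorm_ge0 (x - xs)) k2M; move: xr D0; lra.
have [|x' [x'D fx' gx' x'x]] := @gd_error_bound x.
  rewrite (le_lt_trans _ xr)// mulrDr mulr1 lerD2l.
  rewrite (_ : _ * (_ * M) = 4 * kap * (kap * M * enorm (x - xs))).
    by rewrite ler_wpM2l ?gap_le// mulr_ge0// ltW.
  by ring.
exists (x - x'); rewrite enormBC; split=> //.
  have /(grad_taylor xD) : enorm (x + (x' - x) - xs) < D by rewrite subrKC.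
  rewrite subrKC gx' sub0r -[x' - x]opprB mulmxN opprK addrC => le1.
  by move: le1; rewrite enormN enormBC.
move=> v.
have Hx' := hess_min_ge0 v x'D fx' gx'.
have -> : H x = H x' + (H x - H x') by rewrite subrKC.
rewrite mulmxDl edotDr -[leLHS]add0r lerD// mulNr lerNl -edotNr.
rewrite (le_trans (edot_le_enorm _ _))// enormN.
have := ler_wpM2l (enorm_ge0 v) (hess_lip v xD x'D).
move/le_trans; apply.
rewrite enormBC [X in X <= _](_ : _ = L * enorm (x' - x) * enorm v ^+ 2).
  by rewrite ler_wpM2r ?sqr_ge0// ler_wpM2l.
by ring.
Qed.

End GradientDescent.
End LocalModel.

(** * MINRES on positive definite systems *)

Section Minres.
Variables (R : realType) (n : nat).
Implicit Types (A : 'M[R]_n) (b p q u v w : 'cV[R]_n) (t : nat).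

Lemma krylovS A b t q :
  reflect (exists c w, w \in krylov A b t /\ q = c *: b + A *m w)
          (q \in krylov A b t.+1).
Proof.
pose K := [seq iter i (mulmx A) b | i <- iota 0 t].
have mapA : <<[seq iter i (mulmx A) b | i <- iota 1 t]>>%VS
          = (linfun (mulmx A) @: <<K>>)%VS.
  rewrite limg_span -map_comp (iotaDl 1 0) -map_comp.
  by congr (<< _ >>)%VS; apply: eq_map => i /=; rewrite lfunE.
rewrite /krylov /= span_cons mapA -/K.
apply: (iffP memv_addP) => [[_ /vlineP[c ->] [_ /memv_imgP[w wK ->] ->]]|].
  by exists c, w; rewrite lfunE.
move=> [c [w [wK ->]]]; exists (c *: b); first by rewrite memvZ ?memv_line.
by exists (A *m w) => //; rewrite -[A *m w](lfunE (mulmx A)) memv_img.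
Qed.

Lemma krylov0 A b q : q \in krylov A b 0 -> q = 0.
Proof. by rewrite /krylov /= span_nil memv0 => /eqP. Qed.

Lemma krylov_subS A b t q : q \in krylov A b t -> q \in krylov A b t.+1.
Proof.
elim: t q => [|t IH] q; first by move=> /krylov0 ->; rewrite mem0v.
by move=> /krylovS[c [w [/IH wK ->]]]; apply/krylovS; exists c, w.
Qed.

Lemma krylov_gen A b t : b \in krylov A b t.+1.
Proof. by apply/krylovS; exists 1, 0; rewrite mem0v mulmx0 addr0 scale1r. Qed.

Lemma krylov_shiftP A b t q :
  reflect (exists2 w, w \in krylov A b t & q = A *m w)
          (q \in krylov A (A *m b) t).
Proof.
apply: (iffP idP) => [|[w wK ->]].
  elim: t q => [|t IH] q.
    by move=> /krylov0 ->; exists 0; rewrite ?mem0v ?mulmx0.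
  move=> /krylovS[c [_ [/IH[w wK ->] ->]]].
  exists (c *: b + A *m w); first by apply/krylovS; exists c, w.
  by rewrite mulmxDr -scalemxAr.
elim: t w wK => [|t IH] w; first by move=> /krylov0 ->; rewrite mulmx0 mem0v.
move=> /krylovS[c [v [/IH vK ->]]]; apply/krylovS; exists c, (A *m v).
by rewrite mulmxDr -scalemxAr.
Qed.

Lemma projection_exists (s : seq 'cV[R]_n) b :
  exists2 w, w \in << s >>%VS & forall u, u \in << s >>%VS -> edot u (b - w) = 0.
Proof.
elim: s b => [|a s IH] b.
  exists 0; first by rewrite mem0v.
  by move=> u; rewrite span_nil memv0 => /eqP->; rewrite edotC edot0r.
have [wa waK oa] := IH a; have [wb wbK ob] := IH b.
have sub u : u \in << s >>%VS -> u \in <<a :: s>>%VS.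
  by move: u; apply/subvP; rewrite span_cons addvSr.
have aK : a \in <<a :: s>>%VS by rewrite memv_span// mem_head.
pose a' := a - wa; pose c := edot a' (b - wb) / edot a' a'.
exists (wb + c *: a').
  by apply: memvD (sub _ wbK) (memvZ _ (memvB aK (sub _ waK))).
move=> u; rewrite span_cons => /memv_addP[_ /vlineP[l ->] [v vK ->]].
have vo : edot v (b - (wb + c *: a')) = 0.
  by rewrite opprD addrA edotBr ob// edotZr oa// mulr0 subrr.
have wao : edot wa (b - (wb + c *: a')) = 0.
  by rewrite opprD addrA edotBr ob// edotZr oa// mulr0 subrr.
have -> : l *: a = l *: a' + l *: wa by rewrite -scalerDr subrK.
rewrite !edotDl !edotZl vo wao mulr0 !addr0 opprD addrA edotBr edotZr /c.
have [->|a'0] := eqVneq a' 0.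
  by rewrite !(edotC 0) !edot0r mulr0 subrr mulr0.
by rewrite divfK ?subrr ?mulr0// edot_eq0.
Qed.

(** The projection is taken onto the image of the Krylov space by [A], which
is the Krylov space generated by [A *m b]. *)
Lemma krylov_projection A b t :
  exists2 p, p \in krylov A b t &
    forall q, q \in krylov A b t -> edot (A *m q) (b - A *m p) = 0.
Proof.
have [_ /krylov_shiftP[p pK ->] o] :=
  projection_exists [seq iter i (mulmx A) (A *m b) | i <- iota 0 t] b.
by exists p => // q qK; apply: o; apply/krylov_shiftP; exists q.
Qed.

(** Variational characterization: compare [p] with its perturbation by the
best multiple of [q]. *)
Lemma krylov_argmin_orth A b t p q : krylov_argmin A b t p ->
  q \in krylov A b t -> edot (A *m q) (b - A *m p) = 0.
Proof.
move=> [pK +] qK; move rE: (b - A *m p) => r pmin.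
have [->|Aq0] := eqVneq (A *m q) 0; first by rewrite edotC edot0r.
have N0 := edot_gt0 Aq0; set N := edot (A *m q) (A *m q) in N0.
pose c := edot (A *m q) r; pose tau := c / N.
have := pmin (p + tau *: q) (memvD pK (memvZ _ qK)).
rewrite -(@ler_pXn2r _ 2) ?nnegrE ?enorm_ge0// !sqr_enorm.
rewrite mulmxDr -scalemxAr opprD addrA rE.
rewrite !(edotBl, edotBr) !(edotZl, edotZr) [edot r (A *m q)]edotC -/c -/N.
rewrite [tau * (tau * N)](_ : _ = tau * c); last first.
  by rewrite /tau; congr (_ * _); rewrite divfK// gt_eqF.
rewrite opprB addrA subrK -subr_ge0 addrAC subrr sub0r /tau oppr_ge0.
rewrite mulrAC -expr2 pmulr_lle0 ?invr_gt0// => c2.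
by apply/eqP; rewrite -sqrf_eq0 eq_le sqr_ge0 c2.
Qed.

Definition posdef A := A^T = A /\ forall v, v != 0 -> 0 < edot v (A *m v).

Lemma posdef_sym A u v : posdef A -> edot (A *m u) v = edot u (A *m v).
Proof. by case=> As _; rewrite edot_trmx As. Qed.

Lemma posdef_ge0 A v : posdef A -> 0 <= edot v (A *m v).
Proof.
by case=> _ Ap; have [->|/Ap/ltW//] := eqVneq v 0; rewrite mulmx0 edot0r.
Qed.

(** The MINRES iterates make an acute angle with their residuals. Induction on
the dimension, with [A *m b] as the new right-hand side: let [A *m v] be the
previous iterate for it and [u = b - A *m v]. Then [A *m u] is orthogonal to
the image of the smaller space, and [p = c *: u + A *m w'], so that by
orthogonality [p . r = c |r|^2]. Testing [r] against [A *m u] gives [c |A u|^2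
= u . A u + (A v) . A u], where the first term is nonnegative because [A] is,
and the second one by the induction hypothesis. *)
Lemma minres_iterate_residual_ge0 A : posdef A -> forall t b p,
  p \in krylov A b t ->
  (forall q, q \in krylov A b t -> edot (A *m q) (b - A *m p) = 0) ->
  0 <= edot p (b - A *m p).
Proof.
move=> Apd; elim=> [|t IH] b p.
  by move=> /krylov0 -> _; rewrite edotC edot0r.
move=> pK orth; have [_ /krylov_shiftP[v vK ->] orth'] :=
  krylov_projection A (A *m b) t.
have Av_shift : A *m v \in krylov A (A *m b) t.
  by apply/krylov_shiftP; exists v.
have {IH Av_shift} := IH (A *m b) (A *m v) Av_shift orth'.
set r := b - A *m p in orth *; rewrite -mulmxBr; move uE: (b - A *m v) => u vu.
have bK := krylov_gen A b t; have vK' := krylov_subS vK.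
have AvK : A *m v \in krylov A b t.+1.
  by apply/krylovS; exists 0, v; rewrite scale0r add0r.
have uK : u \in krylov A b t.+1 by rewrite -uE memvB.
have br : edot b r = edot r r.
  by rewrite -[in LHS](subrK (A *m p) b) edotDl -/r orth// addr0.
case/krylovS: (pK) => c [w [wK pE]].
pose w' := c *: v + w.
have w'K : w' \in krylov A b t by rewrite memvD// memvZ.
have {}pE : p = c *: u + A *m w'.
  by rewrite pE -uE /w' mulmxDr -scalemxAr scalerBr addrA subrK.
have -> : edot p r = c * edot r r.
  rewrite pE edotDl edotZl [edot (A *m w') r]orth; last exact: krylov_subS.
  by rewrite addr0 -uE edotBl [edot (A *m v) r]orth// subr0 br.
have cE : c * edot (A *m u) (A *m u) = edot u (A *m u) + edot (A *m v) (A *m u).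
  have o1 := orth _ uK.
  have o2 : edot (A *m (A *m w')) (A *m u) = 0.
    rewrite -uE mulmxBr orth'//; apply/krylov_shiftP; by exists w'.
  move: o1; rewrite /r edotBr pE mulmxDr edotDr -scalemxAr edotZr.
  rewrite [edot (A *m u) (A *m (A *m w'))]edotC o2 addr0 => /subr0_eq <-.
  by rewrite -edotDl -uE subrK edotC.
(* If [u = 0], the system is solved exactly in the current space and [r = 0]. *)
have [u0|u0] := eqVneq u 0.
  have : edot r r = 0.
    rewrite -[RHS](orth (v - p)) ?memvB// mulmxBr.
    congr (edot _ _); rewrite /r; congr (_ - _).
    by apply/eqP; rewrite -subr_eq0 uE u0.
  by move=> ->; rewrite mulr0.
rewrite mulr_ge0 ?edot_ge0//.
have Au0 : A *m u != 0.
  apply: contraTneq (Apd.2 _ u0) => ->; by rewrite edot0r ltxx.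
by rewrite -(pmulr_lge0 _ (edot_gt0 Au0)) cE addr_ge0// posdef_ge0.
Qed.

(** Every residual met before the stop is nonzero, so positive definiteness
rules out the curvature exit. *)
Lemma minres_posdef A b theta d fl : posdef A -> b != 0 -> 0 <= theta ->
  minres A b theta d fl ->
  [/\ fl = SOL, enorm (b - A *m d) <= theta * enorm b,
    0 <= edot d (b - A *m d), edot (A *m d) (b - A *m d) = 0
    & edot (A *m b) (b - A *m d) = 0].
Proof.
move=> Apd b0 th0 [p [p0 pmin [t [t0 before]]]].
have r0 : b - A *m p t.-1 != 0.
  case: t t0 before => // [[|t]] _ before; first by rewrite p0 mulmx0 subr0.
  have /before : (0 < t.+1 < t.+2)%N by rewrite ltnSn.
  case/andP => _; rewrite -ltNge => /(le_lt_trans _); rewrite -enorm_gt0; apply.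
  by rewrite mulr_ge0// enorm_ge0.
rewrite leNgt Apd.2//= => -[sol -> ->].
have orth := krylov_argmin_orth (pmin t t0); have [pK _] := pmin t t0.
have bK : b \in krylov A b t by rewrite -(prednK t0) krylov_gen.
split=> //; [exact: minres_iterate_residual_ge0 orth | exact: orth|exact: orth].
Qed.

End Minres.

(** * The regularized Newton direction *)

(** Here [g] and [H] are the gradient and the Hessian at a point, [e] is its
displacement from a nearby minimizer as in [local_geometry], and [d] is an
approximate solution of the Newton system regularized by [zeta]. The decisive
condition is [zeta_ge]: [zeta] dominates a large multiple of [|g|], hence also
the possible negative curvature of [H] and the second order error in [He]. *)
Section NewtonDirection.
Variables (R : realType) (n : nat) (H : 'M[R]_n) (g e d : 'cV[R]_n).
Variables (L M Ce Ct cZ Z0 zeta theta : R).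
Implicit Types v w : 'cV[R]_n.
Hypothesis H_sym : H^T = H.
Hypothesis H_le : forall v, enorm (H *m v) <= M * enorm v.
Hypothesis H_ge : forall v,
  - (L * (Ce * enorm g)) * enorm v ^+ 2 <= edot v (H *m v).
Hypothesis e_le : enorm e <= Ce * enorm g.
Hypothesis He : enorm (H *m e - g) <= L * enorm e ^+ 2.
Hypotheses (L0 : 0 <= L) (M0 : 0 < M) (Ce0 : 0 <= Ce) (Ct0 : 0 <= Ct).
Hypotheses (zeta0 : 0 < zeta) (zeta_le : zeta <= cZ).
Hypothesis zeta_ge : Z0 * enorm g <= zeta.
Hypothesis Z0_ge : 2 * L * Ce <= Z0.
Hypothesis theta_le : theta <= Ct * zeta.
Hypothesis g0 : g != 0.

Let A := H + zeta%:M.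
Let MA := M + cZ.

Let AE v : A *m v = H *m v + zeta *: v.
Proof. by rewrite mulmxDl mul_scalar_mx. Qed.

Let gN0 : 0 < enorm g. Proof. by rewrite enorm_gt0. Qed.

Let MA0 : 0 < MA.
Proof. by rewrite addr_gt0// (lt_le_trans zeta0). Qed.

Lemma curvature_le_reg : L * (Ce * enorm g) <= zeta / 2.
Proof.
have := ler_wpM2r (enorm_ge0 g) Z0_ge; move: zeta_ge; lra.
Qed.

Lemma reg_coercive v : zeta / 2 * enorm v ^+ 2 <= edot v (A *m v).
Proof.
rewrite AE edotDr edotZr -sqr_enorm.
have := ler_wpM2r (sqr_ge0 (enorm v)) curvature_le_reg.
by have := H_ge v; rewrite mulNr; lra.
Qed.

Lemma reg_posdef : posdef A.
Proof.
split; first by rewrite linearD /= tr_scalar_mx H_sym.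
move=> v v0; rewrite (lt_le_trans _ (reg_coercive v))//.
by rewrite mulr_gt0 ?divr_gt0// exprn_gt0// enorm_gt0.
Qed.

Lemma reg_expand v : zeta / 2 * enorm v <= enorm (A *m v).
Proof.
have [->|v0] := eqVneq v 0; first by rewrite mulmx0 enorm0 mulr0.
rewrite -(@ler_pM2l _ (enorm v)) ?enorm_gt0//.
rewrite (le_trans _ (edot_le_enorm _ _))// (le_trans _ (reg_coercive v))//.
by rewrite expr2 mulrCA.
Qed.

Lemma reg_le v : enorm (A *m v) <= MA * enorm v.
Proof.
rewrite AE (le_trans (ler_enormD _ _))// enormZ gtr0_norm// mulrDl lerD//.
by rewrite ler_wpM2r ?enorm_ge0.
Qed.

Let r := - g - A *m d.
Hypothesis r_le : enorm r <= theta * enorm g.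
Hypothesis dr : 0 <= edot d r.
Hypothesis Agr : edot (A *m - g) r = 0.

(** The bound does not degrade with the conditioning [1 / zeta] of the system
because [- e] almost solves it: [A (d + e)] consists of the residual, of order
[zeta |g|], of the second order error [H e - g], dominated by [zeta |g|], and
of [zeta *: e]. *)
Lemma direction_le : enorm d <= (2 * Ct + 4 * Ce) * enorm g.
Proof.
have rz : enorm r <= Ct * zeta * enorm g.
  by rewrite (le_trans r_le)// ler_wpM2r ?enorm_ge0.
have key : zeta / 2 * enorm (d + e) <=
    zeta / 2 * ((2 * Ct + 3 * Ce) * enorm g).
  have E : A *m (d + e) = - r + (H *m e - g) + zeta *: e.
    by rewrite mulmxDr [A *m e]AE /r; apply/colP => i; rewrite !mxE; ring.
  rewrite (le_trans (reg_expand _))// E.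
  rewrite (le_trans (ler_enormD _ _))//.
  have := ler_enormD (- r) (H *m e - g).
  rewrite enormN enormZ gtr0_norm//.
  have : L * enorm e ^+ 2 <= zeta / 2 * (Ce * enorm g).
    rewrite expr2 mulrA ler_pM ?mulr_ge0 ?enorm_ge0//.
    by rewrite (le_trans _ curvature_le_reg)// ler_wpM2l.
  have := ler_wpM2l (ltW zeta0) e_le; move: rz He; lra.
have := ler_enormB (d + e) e; rewrite addrK => /le_trans; apply.
by move: key e_le; rewrite ler_pM2l ?divr_gt0//; lra.
Qed.

(** If [theta] is small the residual is only a fraction of [g]; if it is not,
then [zeta] is bounded away from 0 and [A] is well conditioned, so that
already the first Krylov vector reduces the residual. Adding the two estimates
covers both cases at once. *)
Lemma image_ge : enorm g <= (1 + 2 * Ct * MA) * enorm (A *m d).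
Proof.
have rz : enorm r <= Ct * zeta * enorm g.
  by rewrite (le_trans r_le)// ler_wpM2r ?enorm_ge0.
have tri : enorm g <= enorm (A *m d) + enorm r.
  by rewrite -[g]opprK enormN -[- g](subrK (A *m d)) addrC ler_enormD.
have low : zeta / 2 * enorm g <= MA * enorm (A *m d).
  rewrite -(@ler_pM2l _ (enorm g))// mulrCA -expr2 -[enorm g]enormN.
  rewrite (le_trans (reg_coercive _))//.
  have -> : edot (- g) (A *m - g) = edot (A *m - g) (A *m d).
    by apply/eqP; rewrite edotC -subr_eq0 -edotBr Agr.
  rewrite (le_trans (edot_le_enorm _ _))// mulrA [_ * MA]mulrC.
  by rewrite ler_wpM2r ?enorm_ge0 ?reg_le.
have := ler_wpM2l Ct0 low; move: rz tri; lra.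
Qed.

Lemma image_sqr_le : enorm (A *m d) ^+ 2 <= MA * edot d (A *m d).
Proof.
pose w := d - MA^-1 *: (A *m d).
have := posdef_ge0 w reg_posdef.
have Apd := reg_posdef.
rewrite {1}/w edotBl -(posdef_sym _ _ Apd) edotZl /w mulmxBr -scalemxAr.
rewrite !edotBr !edotZr -sqr_enorm [edot (A *m d) d]edotC.
have := le_trans (edot_le_enorm (A *m d) _)
  (ler_wpM2l (enorm_ge0 _) (reg_le (A *m d))).
set q := edot d (A *m d); set N := enorm (A *m d).
set m := edot (A *m d) (A *m (A *m d)) => m_le w0.
have {}w0 : 0 <= MA * (q - MA^-1 * N ^+ 2 - MA^-1 * (N ^+ 2 - MA^-1 * m)).
  by rewrite mulr_ge0 ?(ltW MA0).
have mE : MA * (q - MA^-1 * N ^+ 2 - MA^-1 * (N ^+ 2 - MA^-1 * m)) =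
  MA * q - 2 * N ^+ 2 + MA^-1 * m by field; rewrite gt_eqF.
have : MA^-1 * m <= N ^+ 2.
  by rewrite ler_pdivrMl//; move: m_le; rewrite mulrCA -expr2.
by move: w0; rewrite mE; lra.
Qed.

Lemma slope_le :
  edot g d <= - (((1 + 2 * Ct * MA) ^+ 2 * MA)^-1 * enorm g ^+ 2).
Proof.
have gE : edot g d = - edot d (A *m d) - edot d r.
  by rewrite /r edotBr edotNr [edot g d]edotC; ring.
have c0 : 0 < (1 + 2 * Ct * MA) ^+ 2.
  by rewrite exprn_gt0// ltr_pwDl// !mulr_ge0// ltW.
suff : ((1 + 2 * Ct * MA) ^+ 2 * MA)^-1 * enorm g ^+ 2 <= edot d (A *m d).
  by move: dr; rewrite gE; lra.
rewrite (ler_pdivrMl _ _ (mulr_gt0 c0 MA0)) -[leRHS]mulrA.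
rewrite (le_trans _ (ler_wpM2l (ltW c0) image_sqr_le))// -exprMn.
by rewrite ler_pXn2r ?nnegrE ?mulr_ge0 ?enorm_ge0 ?image_ge ?addr_ge0
  ?mulr_ge0 ?(ltW MA0).
Qed.

(** With [r] the residual, [d . A d = - g . d - r . d]; the term [r . d] has
the right sign, and the shift by [zeta] leaves a quadratic reserve. *)
Lemma model_le :
  edot g d + 2^-1 * edot d (H *m d) <=
  2^-1 * edot g d - zeta / 2 * enorm d ^+ 2.
Proof.
have : edot d r = - edot g d - edot d (H *m d) - zeta * enorm d ^+ 2.
  rewrite /r AE edotBr edotNr edotDr edotZr sqr_enorm opprD addrA.
  by rewrite [edot d g]edotC.
by move: dr; lra.
Qed.

Lemma linear_residual_le :
  enorm (g + H *m d) <= (3 * Ct + 4 * Ce) * (zeta * enorm g).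
Proof.
have -> : g + H *m d = - r - zeta *: d.
  by rewrite /r AE opprB opprK [_ + g]addrC !addrA addrK.
rewrite (le_trans (ler_enormB _ _))// enormN enormZ gtr0_norm//.
have rz : enorm r <= Ct * zeta * enorm g.
  by rewrite (le_trans r_le)// ler_wpM2r ?enorm_ge0.
have := ler_wpM2l (ltW zeta0) direction_le; move: rz; lra.
Qed.

End NewtonDirection.

(** * One iteration near the limit *)

Section NewtonStep.
Variables (R : realType) (n : nat) (f : 'cV[R]_n -> R) (xs : 'cV[R]_n).
Variables (D L kap M sigma cZ Ct : R).
Hypothesis df : forall x : 'cV[R]_n, differentiable f x.
Hypothesis dg : forall x : 'cV[R]_n, differentiable (grad f) x.
Hypotheses (D0 : 0 < D) (L0 : 0 <= L) (kap0 : 0 < kap) (M0 : 0 < M).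
Hypothesis hess_lip : forall y z v : 'cV[R]_n,
  enorm (y - xs) < D -> enorm (z - xs) < D ->
  enorm (((hess f y)^T - (hess f z)^T) *m v) <= L * enorm (y - z) * enorm v.
Hypothesis fmin : forall y, enorm (y - xs) < D -> f xs <= f y.
Hypothesis PL : forall y, enorm (y - xs) < D ->
  f y - f xs <= (kap * enorm (grad f y)) ^+ 2.
Hypothesis hess_le : forall y v,
  enorm (y - xs) < D -> enorm ((hess f y)^T *m v) <= M * enorm v.
Hypotheses (sigma0 : 0 < sigma) (sigma_lt : sigma < 2^-1).
Hypotheses (cZ0 : 0 < cZ) (Ct0 : 0 <= Ct).

Let Ce := 4 * kap ^+ 2.
Let Cd := 2 * Ct + 4 * Ce.
Let c1 := ((1 + 2 * Ct * (M + cZ)) ^+ 2 * (M + cZ))^-1.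

Let Ce0 : 0 < Ce. Proof. by rewrite mulr_gt0// exprn_gt0. Qed.
Let Cd0 : 0 < Cd. Proof. by rewrite ltr_wpDl ?mulr_ge0// mulr_gt0. Qed.
Let c10 : 0 < c1.
Proof.
have MA0 : 0 < M + cZ by rewrite addr_gt0.
by rewrite invr_gt0 mulr_gt0// exprn_gt0// ltr_pwDl// !mulr_ge0// ltW.
Qed.

(** The regularized Hessian is positive definite, so MINRES returns a solution
and the safeguard keeps it; the reserve of [model_le] absorbs the cubic Taylor
remainder, so the model decreases by at least half the slope, and [sigma <
1/2] makes the unit step acceptable. *)
Lemma newton_step rho alpha cA a theta zeta x x' :
  enorm (x - xs) * (1 + Ce * M) < D / 2 ->
  enorm (x - xs) * (Cd * M) < D / 2 ->
  symmetric_mx (hess f x) -> grad f x <> 0 ->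
  0 < zeta <= cZ -> 2 * L * (Ce + Cd) * enorm (grad f x) <= zeta ->
  0 <= theta <= Ct * zeta ->
  2 * Num.min cA (a * enorm (grad f x) `^ alpha) <= zeta ->
  minres_ls_step f rho sigma alpha cA 1 theta a zeta (hess f x) x x' ->
  [/\ enorm (x' - xs) < D,
      enorm (x' - x) <= Cd * enorm (grad f x),
      f x' <= f x - sigma * c1 * enorm (grad f x) ^+ 2
    & enorm (grad f x') <= (3 * Ct + 4 * Ce + Cd) * (zeta * enorm (grad f x))].
Proof.
move=> xr1 xr2 Hsym gx0 /andP[zeta0 zeta_le] zeta_ge /andP[th0 th_le] thr.
set g := grad f x in gx0 zeta_ge thr *; set H := hess f x in Hsym *.
have xD : enorm (x - xs) < D.
  have k : 0 <= Ce * M by rewrite mulr_ge0// ltW.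
  by have := mulr_ge0 (enorm_ge0 (x - xs)) k; move: xr1 D0; lra.
have [e [e_le He Hge]] :=
  local_geometry df dg D0 L0 hess_lip kap0 fmin PL M0 hess_le xr1.
rewrite Hsym in He Hge.
have H_le v : enorm (H *m v) <= M * enorm v by rewrite -Hsym hess_le.
have g0 : g != 0 by apply/eqP.
have LCe : 2 * L * Ce <= 2 * L * (Ce + Cd).
  by rewrite ler_wpM2l ?mulr_ge0// lerDl ltW.
have Apd := reg_posdef Hsym Hge zeta0 zeta_ge LCe.
move=> [d0 [fl0 [d [fl [lam [MIN SAFE STEP ->]]]]]].
have [|flE r_le dr _ Agr] := minres_posdef Apd _ th0 MIN.
  by rewrite oppr_eq0.
rewrite enormN in r_le.
have dir_le := direction_le Hge e_le He L0 zeta0 zeta_ge LCe th_le r_le.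
have slope := slope_le Hsym H_le Hge M0 Ct0 zeta0 zeta_le zeta_ge LCe th_le
  g0 r_le dr Agr.
have model := model_le dr.
have lres := linear_residual_le Hge e_le He L0 zeta0 zeta_ge LCe th_le r_le.
have coer := reg_coercive Hge zeta_ge LCe d0.
rewrite -/g -/Ce -/Cd -/c1 in dir_le slope model lres.
have [dE flE'] : d = d0 /\ fl = SOL.
  move: SAFE; rewrite flE /safeguard ltNge (le_trans _ coer) /=.
    by case=> -> ->.
  rewrite ler_wpM2r ?sqr_ge0//; move: thr; rewrite -/g; lra.
rewrite dE flE' /= in STEP *; clear SAFE dE flE'.
have gN0 : 0 <= enorm g := enorm_ge0 g.
have xdD : enorm (x + d0 - xs) < D.
  have := ler_enormD (x - xs) d0; rewrite addrAC.
  have : Cd * enorm g <= enorm (x - xs) * (Cd * M).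
    rewrite mulrCA ler_wpM2l ?(ltW Cd0)// [leRHS]mulrC.
    exact: (grad_le df dg D0 fmin M0 hess_le xD).
  have := mulr_ge0 (enorm_ge0 (x - xs)) (mulr_ge0 (ltW Ce0) (ltW M0)).
  by move: xr2 xr1 dir_le; lra.
have Ld : L * enorm d0 <= zeta / 2.
  have : L * enorm d0 <= L * ((Ce + Cd) * enorm g).
    by rewrite ler_wpM2l// (le_trans dir_le)// ler_wpM2r// lerDr ltW.
  by move: zeta_ge; lra.
have slope0 : edot g d0 <= 0.
  by rewrite (le_trans slope)// oppr_le0 mulr_ge0 ?sqr_ge0// ltW.
have arm : f (x + d0) - f x <= sigma * edot g d0.
  have := taylor2 df dg L0 hess_lip xD xdD; rewrite Hsym -/g -/H => T.
  have : L * enorm d0 ^+ 3 <= zeta / 2 * enorm d0 ^+ 2.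
    by rewrite [enorm d0 ^+ 3]exprS mulrA ler_wpM2r ?sqr_ge0.
  have : 2^-1 * edot g d0 <= sigma * edot g d0 by rewrite ler_wnM2r// ltW.
  by move: T model; lra.
have -> : lam = 1.
  case: STEP => j [_ _ jmin ->].
  have : (j <= 0)%N.
    apply: jmin => //; rewrite expr0 mulr1 /armijo scale1r mulr1.
    by rewrite [edot d0 _]edotC.
  by rewrite leqn0 => /eqP ->; rewrite expr0 mulr1.
rewrite scale1r; split=> //.
- by rewrite addrC addKr.
- have := ler_wpM2l (ltW sigma0) slope; move: arm; lra.
have := grad_taylor dg L0 hess_lip xD xdD; rewrite Hsym -/g -/H => T.
have := ler_enormD (grad f (x + d0) - g - H *m d0) (g + H *m d0).
rewrite -[_ - _ - _]addrA -opprD subrK opprD addrA => tri.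
have : L * enorm d0 ^+ 2 <= zeta / 2 * (Cd * enorm g).
  by rewrite expr2 mulrA ler_pM ?mulr_ge0 ?enorm_ge0.
have : 0 <= zeta * (Cd * enorm g) by rewrite !mulr_ge0// ltW.
by move: T tri lres; lra.
Qed.

End NewtonStep.

(** * Sequences *)

Section Sequences.
Variable R : realType.

Lemma accumulation_frequently (n : nat) (x : nat -> 'cV[R]_n) xs (e : R) N :
  accumulation_points x xs -> 0 < e ->
  exists2 k, (N <= k)%N & enorm (x k - xs) < e.
Proof.
rewrite /accumulation_points /= limn_einf_lim => lim0 e0.
apply: contrapT => far.
have : (e%:E <= limn (einfs (fun k => (enorm (x k - xs))%:E)))%E.
  apply: lime_ge; first exact: is_cvg_einfs.
  exists N => // m /= Nm; apply: le_ereal_inf_tmp => _ [k /= mk <-].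
  rewrite lee_fin leNgt; apply/negP => ke; apply: far.
  by exists k => //; exact: leq_trans Nm mk.
by rewrite lim0 lee_fin leNgt e0.
Qed.

(** The terms of a convergent series tend to 0, so the bases tend to infinity.
*)
Lemma summable_powRN_large (z : nat -> R) (p zbar Z : R) :
  0 < p -> 0 < zbar -> (forall k, zbar <= z k) ->
  (\sum_(1 <= k <oo) (z k `^ (- p^-1))%:E < +oo)%E ->
  exists N, forall k, (N <= k)%N -> Z <= z k.
Proof.
move=> p0 zb0 hz fin; pose u k := z k `^ (- p^-1).
have u0 k : 0 <= u k := powR_ge0 _ _.
have z0 k : 0 < z k by exact: lt_le_trans (hz k).
have cu : cvgn (series (fun k => u k.+1)).
  apply: nondecreasing_is_cvgn; first exact: nondecreasing_series.
  exists (fine (\sum_(1 <= k <oo) (u k)%:E)%E) => _ [k _ <-].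
  rewrite /series /= -lee_fin fineK; last first.
    by rewrite ge0_fin_numE// nneseries_ge0// => i _ _; rewrite lee_fin.
  rewrite -sumEFin -(big_add1 _ _ 0 k.+1 xpredT (fun i => (u i)%:E)).
  by apply: nneseries_lim_ge => i _ _; rewrite lee_fin.
pose Zm := Num.max Z 1.
have Zm0 : 0 < Zm by rewrite lt_max ltr01 orbT.
have e0 : 0 < Zm `^ (- p^-1) by rewrite powR_gt0.
have /cvgrPdist_lt/(_ _ e0)[N _ hN] := cvg_series_cvg_0 cu.
exists N.+1 => -[//|k] Nk.
have := hN k Nk; rewrite /= sub0r normrN ger0_norm// => uk.
rewrite leNgt; apply/negP => zZ; move: uk; rewrite ltNge => /negP; apply.
rewrite /u !powRN lef_pV2 ?posrE ?powR_gt0//.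
apply: ge0_ler_powR; rewrite ?nnegrE ?invr_ge0 ?(ltW p0) ?(ltW (z0 _)) ?(ltW Zm0)//.
by rewrite (le_trans (ltW zZ))// le_max lexx.
Qed.

(** The recursion [u k.+1 <= K * z k * u k `^ (1 + p)] loses a factor [z k],
which grows slower than any geometric sequence, whereas [u] decreases at least
geometrically; giving up [p - w] in the exponent pays for it. To see this
without logarithms, observe that [z k * v k `^ (p - w)] is eventually
nonincreasing. *)
Lemma superlinear_rate (u v z : nat -> R) (p w q C K : R) (N : nat) :
  0 < w < p -> 0 < q < 1 -> 0 <= C -> 0 <= K ->
  (forall k, 0 < z k) -> z k.+1 / z k @[k --> \oo] --> (1 : R) ->
  (forall k, (N <= k)%N -> [/\ 0 < u k, u k <= C * v k, 0 <= v k,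
     v k.+1 <= q * v k & u k.+1 <= K * z k * u k `^ (1 + p)]) ->
  superlinear_to_zero u (1 + w).
Proof.
move=> /andP[w0 wp] /andP[q0 q1] C0 K0 z0 zlim H.
have pw : 0 < p - w by rewrite subr_gt0.
have geo j : v (N + j)%N <= q ^+ j * v N.
  elim: j => [|j IH]; first by rewrite addn0 expr0 mul1r.
  have [_ _ _ vj _] := H (N + j)%N (leq_addr _ _).
  by rewrite addnS (le_trans vj)// exprS -mulrA ler_wpM2l// ltW.
have [_ _ vN0 _ _] := H N (leqnn N).
split.
  rewrite -(cvg_shiftn N).
  apply: (@squeeze_cvgr _ _ _ _ (fun=> 0) (geometric (C * v N) q)).
  - near=> j; have [uj uv _ _ _] := H (j + N)%N (leq_addl _ _).
    rewrite (ltW uj) (le_trans uv)// /geometric /= -mulrA ler_wpM2l//.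
    by rewrite mulrC addnC geo.
  - exact: cvg_cst.
  - by apply: cvg_geometric; rewrite gtr0_norm.
have qp1 : q `^ (p - w) < 1.
  have E : 1 = 1 `^ (p - w) :> R by rewrite powR1.
  rewrite [ltRHS]E.
  by apply: gt0_ltr_powR; rewrite ?nnegrE// ltW.
have qp0 : 0 < q `^ (p - w) by rewrite powR_gt0.
have e0 : 0 < (q `^ (p - w))^-1 - 1 by rewrite subr_gt0 invf_gt1.
have /cvgrPdist_lt/(_ _ e0)[N' _ hN'] := zlim.
pose N1 := maxn N N'; pose W k := z k * v k `^ (p - w).
have Wdec k : (N1 <= k)%N -> W k.+1 <= W k.
  rewrite geq_max => /andP[Nk N'k].
  have [_ _ vk0 vk _] := H k Nk.
  have [_ _ vk10 _ _] := H k.+1 (leqW Nk).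
  have zk : z k.+1 <= (q `^ (p - w))^-1 * z k.
    have := hN' k N'k; rewrite /= distrC => /(le_lt_trans (ler_norm _)).
    by rewrite ltrD2r ltr_pdivrMr// => /ltW.
  have : v k.+1 `^ (p - w) <= q `^ (p - w) * v k `^ (p - w).
    rewrite -powRM ?(ltW q0)//; apply: ge0_ler_powR; rewrite ?nnegrE ?(ltW pw)//.
    by rewrite mulr_ge0// ltW.
  move=> vv; rewrite /W (le_trans (ler_pM _ _ zk vv)) ?(ltW (z0 _)) ?powR_ge0//.
  by rewrite mulrAC mulrA mulVf ?gt_eqF// mul1r mulrC.
have Wle j : W (N1 + j)%N <= W N1.
  elim: j => [|j IH]; first by rewrite addn0.
  by rewrite addnS (le_trans _ IH)// Wdec// leq_addr.
apply/eqO_exP; exists (1 + K * (C `^ (p - w) * W N1)).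
  by rewrite ltr_pwDl// !mulr_ge0 ?powR_ge0// ltW.
exists N1 => // k /= N1k.
have Nk : (N <= k)%N by rewrite (leq_trans _ N1k)// leq_maxl.
have [uk uv vk0 _ uk1] := H k Nk; have [uk10 _ _ _ _] := H k.+1 (leqW Nk).
rewrite !ger0_norm ?powR_ge0 ?(ltW uk10)//.
rewrite (le_trans uk1)//.
have -> : 1 + p = (1 + w) + (p - w) by ring.
rewrite [u k `^ (1 + w + _)]powRD; last by apply/implyP => _; exact: lt0r_neq0.
rewrite mulrCA [leRHS]mulrC ler_wpM2l ?powR_ge0//.
have uvp : u k `^ (p - w) <= C `^ (p - w) * v k `^ (p - w).
  rewrite -powRM//; apply: ge0_ler_powR; rewrite ?nnegrE ?(ltW pw) ?(ltW uk)//.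
  by rewrite mulr_ge0.
rewrite -[leLHS]mulrA -[leLHS]add0r lerD// ler_wpM2l//.
rewrite (le_trans (ler_wpM2l (ltW (z0 k)) uvp))// mulrCA ler_wpM2l ?powR_ge0//.
by have := Wle (k - N1)%N; rewrite subnKC.
Unshelve. all: by end_near. Qed.

End Sequences.

(** * Local consequences of the hypotheses *)

Section LocalHypotheses.
Variables (R : realType) (n : nat) (f : 'cV[R]_n -> R) (xs : 'cV[R]_n).

(** For the exponent 1/2 the desingularizing function is a square root, and
the inequality becomes the Polyak-Lojasiewicz one. *)
Lemma lojasiewicz_half_PL : continuous_at xs f ->
  has_lojasiewicz f xs 2^-1 -> exists2 kap : R, 0 < kap &
    \forall y \near xs, f y - f xs <= (kap * enorm (grad f y)) ^+ 2.
Proof.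
move=> fcont [c [eta [c0 eta0 loja]]]; exists (c / 2); first by rewrite divr_gt0.
have small : \forall y \near xs, ((f y - f xs)%:E < eta)%E.
  case: eta eta0 {loja} => [eta|_|//]; last by near=> y; rewrite ltry.
  rewrite lte_fin => eta0.
  have /cvgrPdist_lt/(_ _ eta0) := fcont; apply: filterS => y.
  by rewrite distrC lte_fin; apply: le_lt_trans; exact: ler_norm.
near=> y; have [t0|t0] := leP (f y - f xs) 0.
  by rewrite (le_trans t0)// sqr_ge0.
have : 1 <= derive1 (fun t : R => c * t `^ (1 - 2^-1)) (f y - f xs)
             * enorm (grad f y).
  have yeta : ((f y - f xs)%:E < eta)%E by near: y.
  by move: t0 yeta; near: y.
set t := f y - f xs in t0 *; set G := enorm _.
have -> : 1 - 2^-1 = 2^-1 :> R by lra.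
have dE : is_derive t 1 (fun t => c * t `^ 2^-1) (c * (2^-1 * t `^ (2^-1 - 1))).
  by have P := is_derive1_powR 2^-1 t0; exact: (is_deriveZ c P).
have st0 : 0 < Num.sqrt t by rewrite sqrtr_gt0.
rewrite derive1E derive_val powRB; last by apply/implyP => _; exact: lt0r_neq0.
rewrite powR12_sqrt ?(ltW t0)// powRr1 ?(ltW t0)//.
have -> : Num.sqrt t / t = (Num.sqrt t)^-1.
  by rewrite -{2}(sqr_sqrtr (ltW t0)) expr2 invfM mulrA mulfV ?mul1r// gt_eqF.
move=> h; have {}h : Num.sqrt t <= c / 2 * G.
  have := ler_wpM2l (ltW st0) h; rewrite mulr1 => /le_trans; apply.
  rewrite le_eqVlt; apply/orP; left; apply/eqP; field.
  by rewrite gt_eqF.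
rewrite -[leLHS](sqr_sqrtr (ltW t0)) ler_pXn2r ?nnegrE ?(ltW st0)//.
by rewrite mulr_ge0 ?enorm_ge0// divr_ge0// ltW.
Unshelve. all: by end_near. Qed.

Lemma specnorm_tr (M : 'M[R]_n) v : enorm (M^T *m v) <= specnorm M * enorm v.
Proof.
have [->|w0] := eqVneq (M^T *m v) 0.
  by rewrite enorm0 (le_trans _ (enorm_mulmx M v))// enorm_ge0.
rewrite -(@ler_pM2l _ (enorm (M^T *m v))) ?enorm_gt0//.
rewrite -[leLHS]expr2 [leLHS]sqr_enorm edot_trmx trmxK mulrCA mulrA.
rewrite (le_trans (edot_le_enorm _ _))// ler_wpM2r ?enorm_ge0//.
exact: enorm_mulmx.
Qed.

Lemma hess_lipschitz_near (VH : set 'cV[R]_n) : nbhs xs VH ->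
  locally_lipschitz_mx VH (hess f) ->
  exists L : R, 0 <= L /\ exists2 U, nbhs xs U & forall y z v, U y -> U z ->
    enorm (((hess f y)^T - (hess f z)^T) *m v) <= L * enorm (y - z) * enorm v.
Proof.
move=> VHn /(_ xs (nbhs_singleton VHn))[L [U Un HL]].
exists `|L|; split=> //; exists (U `&` VH); first exact: filterI.
move=> y z v Uy Uz; rewrite -linearB /= (le_trans (specnorm_tr _ _))//.
rewrite ler_wpM2r ?enorm_ge0// (le_trans (HL _ _ Uy Uz))//.
by rewrite ler_wpM2r ?enorm_ge0// ler_norm.
Qed.

End LocalHypotheses.

(** Since [p <= 1] and [G <= 1], the power [G `^ p] dominates [G]. *)
Lemma regularization_ge (R : realType) (cZ z p Z0 G : R) :
  0 < G <= 1 -> 0 < p <= 1 -> 0 <= Z0 <= z -> Z0 * G <= cZ ->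
  Z0 * G <= Num.min cZ (z * G `^ p).
Proof.
move=> /andP[G0 G1] /andP[p0 p1] /andP[Z00 Zz] ZG.
rewrite le_min ZG ler_pM//; first exact: ltW.
by rewrite ger1_powR// G0.
Qed.

Lemma small_factor (R : realType) (s : seq (R * R)) :
  all (fun bt => 0 < bt.2) s ->
  exists2 r, 0 < r & all (fun bt => r * bt.1 <= bt.2) s.
Proof.
elim: s => [_|[b t] s IH /= /andP[t0 /[dup] s0 /IH[r r0 /allP rs]]].
  by exists 1.
have b1 : 0 < 1 + `|b| by rewrite ltr_pwDl.
exists (Num.min r (t / (1 + `|b|))); first by rewrite lt_min r0 divr_gt0.
set r' := Num.min _ _; have r'0 : 0 <= r' by rewrite le_min !ltW// divr_gt0.
apply/andP; split.
  rewrite (le_trans (ler_wpM2l r'0 (ler_norm b)))//.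
  have /(ler_wpM2r (normr_ge0 b))/le_trans : r' <= t / (1 + `|b|).
    by rewrite ge_min lexx orbT.
  by apply; rewrite mulrAC ler_pdivrMr// ler_pM2l// lerDr.
apply/allP => -[b' t'] /[dup] bs /rs /=; have /= t'0 := allP s0 _ bs.
have [b'0 _|b'0] := leP b' 0.
  by rewrite (le_trans _ (ltW t'0))// mulr_ge0_le0.
by apply: le_trans; rewrite ler_pM2r// ge_min lexx.
Qed.

(** * Superlinear convergence *)

Theorem theorem3p16 (R : realType) (n : nat) (f : 'cV[R]_n -> R)
  (x0 : 'cV[R]_n) (rho sigma alpha cA s : R)
  (theta a zeta : nat -> R) (B : nat -> 'M[R]_n) (x : nat -> 'cV[R]_n)
  (abar bbar zbar cB cZ beta zexp : R) (b z : nat -> R) (xs : 'cV[R]_n)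
  (hf : twice_continuously_differentiable f)
  (hrho : 0 < rho < 1) (hsigma : 0 < sigma < 1) (halpha : 0 < alpha <= 1)
  (hcA : 0 < cA <= 1) (hs : 0 < s)
  (htheta : forall k, 0 <= theta k) (habar : 0 < abar)
  (ha : forall k, abar <= a k) (hzeta : forall k, 0 <= zeta k)
  (hx : minres_ls_generates f x0 rho sigma alpha cA s theta a zeta B x)
  (h1 : exists2 VH, set_nbhs (accumulation_points x) VH
        & locally_lipschitz_mx VH (hess f))
  (h2 : forall k, B k = hess f (x k))
  (hcB : 0 < cB) (hbeta : 0 < beta) (hbbar : 0 < bbar)
  (hb : forall k, bbar <= b k)
  (h3 : forall k,
    theta k = Num.min cB (b k * enorm (grad f (x k)) `^ beta))
  (hcZ : 0 < cZ) (hzexp : 0 < zexp <= 1) (hzbar : 0 < zbar)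
  (hz : forall k, zbar <= z k)
  (h4 : forall k,
    zeta k = Num.min cZ (z k * enorm (grad f (x k)) `^ zexp))
  (h5a : (\sum_(1 <= k <oo) (a k `^ (- alpha^-1))%:E < +oo)%E)
  (h5z : (\sum_(1 <= k <oo) (z k `^ (- zexp^-1))%:E < +oo)%E)
  (h6b : b k.+1 / b k @[k --> \oo] --> (1 : R))
  (h6z : z k.+1 / z k @[k --> \oo] --> (1 : R))
  (h6zeta : forall k,
    2 * Num.min cA (a k * enorm (grad f (x k)) `^ alpha) <= zeta k)
  (h6theta : (theta : nat -> R^o) =O_\oo (zeta : nat -> R^o))
  (h6sigma : 0 < sigma < 2^-1)
  (* Not among (1)-(6), but the conclusion fails without it: for f(t) = t^2/2
     and s = 1/2 the steps lambda_k = 1/2 are accepted for all k and the rate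
     is only linear. *)
  (hs1 : s = 1)
  (hnostop : forall k, grad f (x k) <> 0)
  (hxs : accumulation_points x xs)
  (hmin : local_minimum f xs)
  (hloja : has_lojasiewicz f xs 2^-1) :
  forall omega : R, 0 < omega < Num.min beta zexp ->
    superlinear_to_zero (fun k => enorm (grad f (x k))) (1 + omega).
Proof.
move=> omega /andP[w0 w_lt].
have wz : omega < zexp by rewrite (lt_le_trans w_lt)// ge_min lexx orbT.
case: hf => df dg _.
have Hsym k : symmetric_mx (hess f (x k)).
  by rewrite -h2; have [] := hx.2 k (fun i _ => hnostop i).
have step k := (hx.2 k (fun i _ => hnostop i)).2 (hnostop k).
case: h1 => VH /(_ xs hxs) VHn VHlip.
have [L [L0 [U Un UL]]] := hess_lipschitz_near VHn VHlip.
have [kap kap0 PLn] :=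
  lojasiewicz_half_PL (differentiable_continuous (df xs)) hloja.
have [D D0 HD] : exists2 D : R, 0 < D & forall y, enorm (y - xs) < D ->
    [/\ U y, f xs <= f y & f y - f xs <= (kap * enorm (grad f y)) ^+ 2].
  by apply/nbhs_enormP; near=> y; split; near: y.
have hess_lip (y y' v : 'cV[R]_n) :
    enorm (y - xs) < D -> enorm (y' - xs) < D ->
    enorm (((hess f y)^T - (hess f y')^T) *m v) <= L * enorm (y - y') * enorm v.
  by move=> /HD[Uy _ _] /HD[Uz _ _]; exact: UL.
have fmin y : enorm (y - xs) < D -> f xs <= f y by case/HD.
have PL y : enorm (y - xs) < D ->
    f y - f xs <= (kap * enorm (grad f y)) ^+ 2 by case/HD.
have [M M0 hess_le] := hess_bounded D0 L0 hess_lip.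
have [Ct [Ct0 [N1 _ HN1]]] := (eqO_exP _ _ _).1 h6theta.
pose Ce := 4 * kap ^+ 2; pose Cd := 2 * Ct + 4 * Ce.
pose c1 := ((1 + 2 * Ct * (M + cZ)) ^+ 2 * (M + cZ))^-1.
have Ce0 : 0 < Ce by rewrite mulr_gt0// exprn_gt0.
have Cd0 : 0 < Cd by rewrite addr_gt0// mulr_gt0.
have MA0 : 0 < M + cZ by rewrite addr_gt0.
have c10 : 0 < c1.
  by rewrite invr_gt0 mulr_gt0// exprn_gt0// addr_gt0// !mulr_gt0.
pose Z0 := 2 * L * (Ce + Cd).
have Z00 : 0 <= Z0 by rewrite !mulr_ge0// ltW// addr_gt0.
have [N2 HN2] := summable_powRN_large Z0 (andP hzexp).1 hzbar hz h5z.
have sig0 : 0 < sigma by case/andP: hsigma.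
have sig2 : sigma < 2^-1 by case/andP: h6sigma.
(* The radius that makes every smallness requirement on the gradient hold,
   the gradient being at most M * r within distance r of xs. *)
have [|r r0 /and5P[/= r1 r2 r3 r4 _]] := @small_factor R
  [:: (1 + Ce * M, D / 2); (Cd * M, D / 2); (M, 1); (Z0 * M, cZ)].
  by rewrite /= divr_gt0// ltr01 hcZ.
have rD : r <= D.
  have : 0 <= r * (Ce * M) by rewrite !mulr_ge0// ltW.
  by move: r1; rewrite mulrDr mulr1; clear -D0; lra.
(* The second bound keeps the contraction factor 1 - c / kap ^+ 2 positive. *)
pose c := Num.min (sigma * c1) (kap ^+ 2 / 2).
have c0 : 0 < c by rewrite lt_min mulr_gt0//= divr_gt0// exprn_gt0.
have ck : c < kap ^+ 2.
  have /le_lt_trans : c <= kap ^+ 2 / 2 by rewrite ge_min lexx orbT.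
  by apply; rewrite ltr_pdivrMr// ltr_pMr ?exprn_gt0// ltr1n.
pose N := maxn N1 N2.
have local k : (N <= k)%N -> enorm (x k - xs) < r ->
    [/\ enorm (x k.+1 - xs) < D,
      enorm (x k.+1 - x k) <= Cd * enorm (grad f (x k)),
      f (x k.+1) <= f (x k) - c * enorm (grad f (x k)) ^+ 2
    & enorm (grad f (x k.+1)) <=
      (3 * Ct + 4 * Ce + Cd) * z k * enorm (grad f (x k)) `^ (1 + zexp)].
  rewrite geq_max => /andP[N1k N2k] xr.
  set G := enorm (grad f (x k)).
  have G0 : 0 < G by rewrite enorm_gt0; apply/eqP; exact: hnostop.
  have GM : G <= r * M.
    rewrite (le_trans (grad_le df dg D0 fmin M0 hess_le (lt_le_trans xr rD)))//.
    by rewrite mulrC ler_wpM2r// ltW.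
  have zk0 : 0 < z k := lt_le_trans hzbar (hz k).
  have zeta_ge : Z0 * G <= zeta k.
    rewrite h4 -/G regularization_ge ?G0 ?Z00 ?HN2 ?(le_trans GM)//.
    by rewrite (le_trans (ler_wpM2l Z00 GM))// mulrCA.
  have zeta_le : zeta k <= cZ by rewrite h4 ge_min lexx.
  have zeta_gt0 : 0 < zeta k.
    by rewrite h4 lt_min hcZ mulr_gt0// powR_gt0.
  have th_le : theta k <= Ct * zeta k.
    by have := HN1 k N1k; rewrite /= !ger0_norm.
  have xr1 : enorm (x k - xs) * (1 + Ce * M) < D / 2.
    by rewrite (lt_le_trans _ r1)// ltr_pM2r// addr_gt0// mulr_gt0.
  have xr2 : enorm (x k - xs) * (Cd * M) < D / 2.
    by rewrite (lt_le_trans _ r2)// ltr_pM2r// mulr_gt0.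
  have stepk := step k; rewrite h2 hs1 in stepk.
  have [] := newton_step df dg D0 L0 kap0 M0 hess_lip fmin PL hess_le
    sig0 sig2 hcZ (ltW Ct0) xr1 xr2 (Hsym k) (hnostop k)
    _ zeta_ge _ (h6zeta k) stepk.
  - by rewrite zeta_gt0.
  - by rewrite htheta.
  rewrite -/Ce -/Cd -/c1 -/G => x'D x'x fx' gx'; split=> //.
    rewrite (le_trans fx')// lerD2l lerN2 ler_wpM2r ?sqr_ge0//.
    by rewrite ge_min lexx.
  rewrite (le_trans gx')// -mulrA ler_wpM2l//.
    by rewrite !addr_ge0 ?mulr_ge0 ?ltW.
  have -> : z k * G `^ (1 + zexp) = (z k * G `^ zexp) * G.
    rewrite [1 + _]addrC powRD; last by apply/implyP => _; exact: lt0r_neq0.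
    by rewrite powRr1 ?(ltW G0)// mulrA.
  by rewrite ler_wpM2r ?(ltW G0)// h4 ge_min lexx orbT.
pose K := 2 * kap * Cd / c.
have K0 : 0 < K by rewrite divr_gt0// !mulr_gt0.
have KM0 : 0 < K * (kap * M) := mulr_gt0 K0 (mulr_gt0 kap0 M0).
have s0 : 0 < 1 + K * (kap * M) by rewrite addr_gt0.
have [k0 Nk0 xk0] :=
  @accumulation_frequently _ _ x xs (r / (1 + K * (kap * M))) N hxs
    (divr_gt0 r0 s0).
have start : enorm (x k0 - xs) + K * gap f xs (x k0) < r.
  have xk0r : enorm (x k0 - xs) < r.
    rewrite (lt_le_trans xk0)// ler_pdivrMr// ler_pMr// lerDl.
    exact: ltW.
  have gl := gap_le df dg D0 kap0 fmin PL M0 hess_le (lt_le_trans xk0r rD).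
  move: xk0; rewrite ltr_pdivlMr//; apply: le_lt_trans.
  by have := ler_wpM2l (ltW K0) gl; lra.
have near_xs k : (k0 <= k)%N -> enorm (x k - xs) < r.
  apply: (trapped kap0 fmin PL c0 (ltW Cd0) rD _ start) => {}k k0k xr.
  by have [] := local k (leq_trans Nk0 k0k) xr.
pose q := Num.sqrt (1 - c / kap ^+ 2).
have q01 : 0 < q < 1.
  have k20 : 0 < kap ^+ 2 by rewrite exprn_gt0.
  have ck0 : 0 < c / kap ^+ 2 by rewrite divr_gt0.
  have ck1 : c / kap ^+ 2 < 1 by rewrite ltr_pdivrMr// mul1r.
  rewrite sqrtr_gt0 subr_gt0 ck1 -[ltRHS]sqrtr1 ltr_sqrt//.
  by rewrite ltrBlDr ltrDl.
apply: (@superlinear_rate _ _ (fun k => gap f xs (x k)) z zexp omega q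
  (Num.sqrt c^-1) (3 * Ct + 4 * Ce + Cd) k0) => //.
- by rewrite w0.
- by rewrite !addr_ge0 ?mulr_ge0 ?ltW.
- by move=> k; exact: lt_le_trans (hz k).
move=> k k0k.
have [x'D _ fx' gx'] := local k (leq_trans Nk0 k0k) (near_xs k k0k).
have xD := lt_le_trans (near_xs k k0k) rD.
split=> //.
- by rewrite enorm_gt0; apply/eqP; exact: hnostop.
- exact: (grad_le_gap fmin c0 x'D fx').
- exact: sqrtr_ge0.
- exact: (gap_contract kap0 fmin PL c0 ck xD x'D fx').
Unshelve. all: by end_near. Qed.
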